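(* Let $W, Z\subseteq\omega$. If $W\not\leq_T Z$ and $f:[\omega]^3\to\omega$ is a $2$-bounded coloring computable from $Z$, then there exists an infinite $f$-rainbow $X\subseteq\omega$ such that $W\not\leq_T Z\oplus X$.
   Context: $[X]^3$ denotes the set of $3$-element subsets of $X$, identified with increasing triples. A function $f:[\omega]^3\to\omega$ is $2$-bounded if $|f^{-1}(c)|\le 2$ for every $c\in\omega$. A set $X\subseteq\omega$ is an $f$-rainbow if $f$ restricted to $[X]^3$ is injective. $\leq_T$ is Turing reducibility and $A\oplus B$ is the Turing join. *)

(* Defs.v *)
From mathcomp Require Import all_boot.
From mathcomp Require Import boolp classical_sets functions cardinality.

Set Implicit Arguments.
Unset Strict Implicit.
Unset Printing Implicit Defensive.

Local Open Scope classical_set_scope.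

(* Kleene's schemes for the partial recursive functions relative to an oracle.
   Codes carry no arity: arguments are read from a list, and a missing argument
   counts as 0. On lists of a fixed length k, codes therefore denote exactly
   the k-ary partial functions recursive in the oracle. *)
Inductive code : Type :=
| Zero
| Succ
| Proj of nat
| Oracle
| Comp of code & seq code
| PrimRec of code & code
| Mu of code.

(* [eval O c v y] : the computation of [c] with oracle [O] on [v] converges
   to [y]. In the case of primitive recursion, [s i] is the value at the
   recursion argument [i]. *)
Fixpoint eval (O : set nat) (c : code) (v : seq nat) (y : nat) {struct c} :
    Prop :=
  match c with
  | Zero => y = 0
  | Succ => y = (head 0 v).+1
  | Proj i => y = nth 0 v i
  | Oracle => y = (head 0 v \in O)
  | Comp h gs => exists w : seq nat,
      all2 (fun g z => `[< eval O g v z >]) gs w /\ eval O h w y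
  | PrimRec g h => exists s : nat -> nat,
      [/\ eval O g (behead v) (s 0),
          forall i, i < head 0 v -> eval O h [:: i, s i & behead v] (s i.+1)
        & y = s (head 0 v)]
  | Mu g => eval O g (y :: v) 0 /\
      forall i, i < y -> exists z, eval O g (i :: v) z.+1
  end.

Definition turing_le (A B : set nat) : Prop :=
  exists c : code, forall n : nat, eval B c [:: n] (n \in A).

Definition turing_join (A B : set nat) : set nat :=
  [set n.*2 | n in A] `|` [set n.*2.+1 | n in B].

(* [omega]^3 *)
Definition triple : Type := {t : 3.-tuple nat | sorted ltn t}.

(* [X]^3 *)
Definition triples (X : set nat) : set triple :=
  [set t | {subset val t <= X}].

Definition two_bounded (f : triple -> nat) : Prop :=
  forall c : nat, (f @^-1` [set c] #<= `I_2)%card.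

Definition computable_from (Z : set nat) (f : triple -> nat) : Prop :=
  exists c : code, forall t : triple, eval Z c (val t) (f t).

Definition rainbow (f : triple -> nat) (X : set nat) : Prop :=
  set_inj (triples X) f.

(* Main.v *)
Require Import Defs.
From mathcomp Require Import all_boot.
From mathcomp Require Import boolp classical_sets functions cardinality.

Set Implicit Arguments.
Unset Strict Implicit.
Unset Printing Implicit Defensive.

Local Open Scope classical_set_scope.

(** Say that an oracle avoids the cone when it does not compute [W].

    The statement reduces to pairs. Some cone-avoiding infinite [C] is so
    cohesive ([avoiding_cohesive]) that for any two pairs the truth of
    [f a b y = f a' b' y] is constant for almost all [y] in [C]. Join two
    pairs by an edge when it is almost always true; since [f] is 2-bounded,
    every pair meets at most one other ([degree_limit_graph]). An infinite
    subset [Y] of [C] that contains no two adjacent pairs can be thinned to an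
    [f]-rainbow by a greedy search: beside a finite rainbow inside [Y], all
    but finitely many elements of [Y] are harmless ([greedy_unbounded]). The
    search is computable from [Z] and [Y], so the cone is still avoided.

    The limit graph need not be computable from anything that avoids the
    cone, so the independent set [Y] must exist for every graph of bounded
    degree, however complex ([avoiding_independent]). It is built by Mathias
    forcing. A condition has a finite stem [F], a cone-avoiding infinite
    reservoir [A] for the later elements, and a promise: a second graph of
    bounded degree, computable from the oracle of the condition, for which
    the set under construction must be independent as well. Given a
    functional, ask for some [n] whether every graph [X] of suitable degree
    admits a finite [E] inside [A] such that [F] with [E] is independent for
    the promise and for [X] and makes the functional err at [n]. By
    compactness this is a question about finite objects.
    - If the answer is yes for some [n], finitely many candidates [E] serve
      all [X]. Use this for [X] the true graph together with the type of a
      point [y] of [A], the graph on points that joins [a] and [c] when [y]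
      turns them into conflicting pairs. Every [y] accepts one of the finitely
      many candidates, so some candidate is accepted by all points of a
      cone-avoiding infinite set ([avoiding_cover]), the new reservoir.
    - If the answer is always no, then for some [n] there is a graph [X] for
      which no [E] yields the correct value at [n]; otherwise [W] could be
      computed by search ([enum_or_miss]). Such [X] form an effectively closed
      class, so one of them avoids the cone ([cone_avoiding_basis]); it is
      added to the promise and prevents the correct value forever.
    The alternative is [tree_dichotomy].

    A cone-avoiding infinite set can be shrunk into one side of any partition
    ([avoiding_split]), by the same dichotomy applied to two forcings at once,
    one for each side; this gives the finite covers and the cohesive set.

    The effective part needs only this: for a fixed code [c], convergence of
    [c] within [s] steps with oracle [turing_join B Y] is a predicate recursive in
    [B] of a code for [Y] below [s] ([converges]). *)

(** * Codes *)

(** The induction principle generated for [code] has no hypothesis for the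
    arguments of a composition; here they are reached by their index. *)
Section CodeInd.
Variable P : code -> Prop.
Hypothesis PZ : P Zero.
Hypothesis PS : P Succ.
Hypothesis PP : forall i, P (Proj i).
Hypothesis PO : P Oracle.
Hypothesis PC : forall h gs, P h -> (forall i, i < size gs -> P (nth Zero gs i)) ->
  P (Comp h gs).
Hypothesis PR : forall g h, P g -> P h -> P (PrimRec g h).
Hypothesis PM : forall g, P g -> P (Mu g).

Fixpoint code_nested_ind (c : code) : P c :=
  match c with
  | Zero => PZ
  | Succ => PS
  | Proj i => PP i
  | Oracle => PO
  | Comp h gs => PC (code_nested_ind h)
      ((fix aux (s : seq code) : forall i, i < size s -> P (nth Zero s i) :=
         match s with
         | [::] => fun i hi => False_ind _ (notF hi)
         | g :: s' => fun i => match i with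
            | 0 => fun _ => code_nested_ind g
            | j.+1 => fun hi => aux s' j hi
            end
         end) gs)
  | PrimRec g h => PR (code_nested_ind g) (code_nested_ind h)
  | Mu g => PM (code_nested_ind g)
  end.
End CodeInd.

Fixpoint tree_of_code (c : code) : GenTree.tree nat :=
  match c with
  | Zero => GenTree.Node 0 [::]
  | Succ => GenTree.Node 1 [::]
  | Oracle => GenTree.Node 2 [::]
  | Proj i => GenTree.Leaf i
  | Comp h gs => GenTree.Node 3 (tree_of_code h :: map tree_of_code gs)
  | PrimRec g h => GenTree.Node 4 [:: tree_of_code g; tree_of_code h]
  | Mu g => GenTree.Node 5 [:: tree_of_code g]
  end.

Fixpoint code_of_tree (t : GenTree.tree nat) : code :=
  match t with
  | GenTree.Leaf i => Proj i
  | GenTree.Node 1 _ => Succ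
  | GenTree.Node 2 _ => Oracle
  | GenTree.Node 3 (t :: ts) => Comp (code_of_tree t) (map code_of_tree ts)
  | GenTree.Node 4 [:: t; u] => PrimRec (code_of_tree t) (code_of_tree u)
  | GenTree.Node 5 [:: t] => Mu (code_of_tree t)
  | _ => Zero
  end.

Lemma tree_of_codeK : cancel tree_of_code code_of_tree.
Proof.
elim/code_nested_ind => //= [h gs -> IH|g h -> ->|g ->] //.
congr Comp; rewrite -map_comp; elim: gs IH => //= g gs IHgs IH.
by rewrite (IH 0) // IHgs // => i hi; exact: (IH i.+1).
Qed.

(** A list of all codes, in which every requirement of a forcing construction
    is met at the index of its code. *)
Definition nth_code (n : nat) : code :=
  if unpickle n is Some t then code_of_tree t else Zero.

Lemma nth_code_surj c : exists n, nth_code n = c.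
Proof. by exists (pickle (tree_of_code c)); rewrite /nth_code pickleK tree_of_codeK. Qed.

Lemma all2_nthP (T U : Type) (x0 : T) (y0 : U) (r : T -> U -> bool) s t :
  reflect (size s = size t /\ forall i, i < size s -> r (nth x0 s i) (nth y0 t i))
          (all2 r s t).
Proof.
apply: (iffP idP).
- elim: s t => [|x s IH] [|y t] //= /andP[rxy /IH[-> IH']]; split=> // -[|i] //=.
  exact: IH'.
- elim: s t => [|x s IH] [|y t] //= [] // [est] H.
  by rewrite (H 0) //=; apply: IH; split=> // i hi; exact: (H i.+1).
Qed.

Lemma eval_CompP O h gs v y : eval O (Comp h gs) v y <->
  exists2 w, size w = size gs /\
    (forall i, i < size gs -> eval O (nth Zero gs i) v (nth 0 w i)) & eval O h w y.
Proof.
split=> [[w [/(all2_nthP Zero 0)[sw H] hw]]|[w [sw H] hw]].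
- by exists w => //; split=> // i /H/asboolP.
- exists w; split=> //; apply/(all2_nthP Zero 0); split=> // i hi.
  exact/asboolP/H.
Qed.

Lemma eval_fun O c v y z : eval O c v y -> eval O c v z -> y = z.
Proof.
elim/code_nested_ind: c v y z => //=.
- by move=> v y z -> ->.
- by move=> v y z -> ->.
- by move=> i v y z -> ->.
- by move=> v y z -> ->.
- move=> h gs IHh IHgs v y z /eval_CompP[w [sw Hw] hw] /eval_CompP[w' [sw' Hw'] hw'].
  suff E : w = w' by rewrite -E in hw'; exact: IHh hw hw'.
  apply: (@eq_from_nth _ 0); first by rewrite sw sw'.
  move=> i; rewrite sw => hi; exact: (IHgs i hi _ _ _ (Hw i hi) (Hw' i hi)).
- move=> g h IHg IHh v y z [s [s0 sS ->]] [t [t0 tS ->]].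
  suff : forall i, i <= head 0 v -> s i = t i by apply.
  elim=> [_|i IH hi]; first exact: IHg s0 t0.
  by apply: IHh (sS i hi) _; rewrite IH 1?ltnW //; exact: tS.
- move=> g IH v y z [y0 yl] [z0 zl].
  case: (ltngtP y z) => // lt.
  + by have [u hu] := zl _ lt; have := IH _ _ _ y0 hu.
  + by have [u hu] := yl _ lt; have := IH _ _ _ z0 hu.
Qed.

(** * Recursive functions of lists of fixed length *)

(** The length is fixed because a code sees only finitely many entries of its
    argument: at a fixed length, every rearrangement of the entries, in
    particular the removal of the first one, is a composition. *)
Definition recfun (O : set nat) (k : nat) (f : seq nat -> nat) : Prop :=
  exists c, forall v, size v = k -> eval O c v (f v).

Lemma eq_recfun O k f g : (forall v, size v = k -> f v = g v) -> recfun O k f ->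
  recfun O k g.
Proof. by move=> E [c Hc]; exists c => v sv; rewrite -E //; exact: Hc. Qed.

Lemma recfun_nth O k i : recfun O k (fun v => nth 0 v i).
Proof. by exists (Proj i). Qed.

Lemma recfun_subst O k f (gs : seq (seq nat -> nat)) : recfun O (size gs) f ->
  (forall i, i < size gs -> recfun O k (nth (fun=> 0) gs i)) ->
  recfun O k (fun v => f [seq g v | g <- gs]).
Proof.
move=> [c Hc] Hgs.
have [ds sds Hds] : exists2 ds, size ds = size gs & forall i, i < size gs ->
    forall v, size v = k -> eval O (nth Zero ds i) v (nth (fun=> 0) gs i v).
  elim: gs Hgs {Hc} => [|g gs IH] Hgs; first by exists [::].
  have [|ds sds Hds] := IH; first by move=> i hi; exact: (Hgs i.+1).
  have [cg Hg] := Hgs 0 isT.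
  by exists (cg :: ds) => [|[|i]] //=; [rewrite sds|exact: Hds].
exists (Comp c ds) => v sv; apply/eval_CompP; exists [seq g v | g <- gs].
  rewrite size_map sds; split=> // i hi.
  by rewrite (nth_map (fun=> 0)) //; exact: Hds.
by apply: Hc; rewrite size_map.
Qed.

Lemma recfun_subst1 O k f a : recfun O 1 (fun v => f (nth 0 v 0)) -> recfun O k a ->
  recfun O k (fun v => f (a v)).
Proof. by move=> Hf Ha; apply: (recfun_subst (gs := [:: a]) Hf) => -[]. Qed.

Lemma recfun_subst2 O k f a b : recfun O 2 (fun v => f (nth 0 v 0) (nth 0 v 1)) ->
  recfun O k a -> recfun O k b -> recfun O k (fun v => f (a v) (b v)).
Proof. by move=> Hf Ha Hb; apply: (recfun_subst (gs := [:: a; b]) Hf) => -[|[]]. Qed.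

Lemma recfun_subst3 O k f a b c :
  recfun O 3 (fun v => f (nth 0 v 0) (nth 0 v 1) (nth 0 v 2)) ->
  recfun O k a -> recfun O k b -> recfun O k c -> recfun O k (fun v =>
    f (a v) (b v) (c v)).
Proof.
by move=> Hf Ha Hb Hc; apply: (recfun_subst (gs := [:: a; b; c]) Hf) => -[|[|[]]].
Qed.

Lemma recfun_subst4 O k f a b c d :
  recfun O 4 (fun v => f (nth 0 v 0) (nth 0 v 1) (nth 0 v 2) (nth 0 v 3)) ->
  recfun O k a -> recfun O k b -> recfun O k c -> recfun O k d ->
  recfun O k (fun v => f (a v) (b v) (c v) (d v)).
Proof.
move=> Hf Ha Hb Hc Hd.
by apply: (recfun_subst (gs := [:: a; b; c; d]) Hf) => -[|[|[|[]]]].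
Qed.

Lemma recfun_behead O k f : recfun O k f -> recfun O k.+1 (fun v => f (behead v)).
Proof.
move=> Hf.
apply: (@eq_recfun _ _ (fun v => f [seq g v | g <- mkseq (fun i v => nth 0 v i.+1) k])).
  case=> //= x v [sv]; rewrite -map_comp; congr f.
  apply: (@eq_from_nth _ 0); rewrite size_map size_iota // => i hi.
  by rewrite (nth_map 0) ?size_iota //= nth_iota.
apply: recfun_subst; rewrite size_mkseq // => i hi; rewrite nth_mkseq //.
exact: recfun_nth.
Qed.

Lemma recfun_S O k a : recfun O k a -> recfun O k (fun v => (a v).+1).
Proof. by move=> Ha; apply: (@recfun_subst1 _ _ succn) Ha; exists Succ; case. Qed.

Lemma recfun_const O k n : recfun O k (fun=> n).
Proof. by elim: n => [|n]; [exists Zero | exact: recfun_S]. Qed.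

Fixpoint primrec (n x : nat) (h : nat -> nat -> nat) : nat :=
  if n is m.+1 then h m (primrec m x h) else x.

(** The initial value and the step may depend on the whole list [v], which the
    code for the step sees behind the index and the previous value. *)
Lemma recfun_primrec O k n g h : recfun O k n -> recfun O k g ->
  recfun O k.+2 (fun w => h (nth 0 w 0) (nth 0 w 1) (behead (behead w))) ->
  recfun O k (fun v => primrec (n v) (g v) (fun i r => h i r v)).
Proof.
move=> Hn [cg Hg] [ch Hh].
pose f w := primrec (head 0 w) (g (behead w)) (fun i r => h i r (behead w)).
pose gs : seq (seq nat -> nat) := n :: mkseq (fun i v => nth 0 v i) k.
apply: (@eq_recfun _ _ (fun v => f [seq g v | g <- gs])) => [v sv|].
  rewrite /f /gs /= -map_comp.
  have -> // : [seq ((fun g : seq nat -> nat => g v) \o (fun i => (nth 0)^~ i)) i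
      | i <- iota 0 k] = v by rewrite -sv; exact: mkseq_nth.
apply: (@recfun_subst _ _ f gs).
  exists (PrimRec cg ch) => -[|x v] //= [sv].
  rewrite size_map size_iota in sv; rewrite /f /=.
  exists (fun i => primrec i (g v) (fun i r => h i r v)); split=> // [|i hi] /=.
    exact: Hg.
  by have /= := Hh [:: i, primrec i (g v) (fun i r => h i r v) & v]; apply; rewrite sv.
rewrite /= size_map size_iota => -[|i] // hi /=.
by rewrite (nth_map 0) ?size_iota // nth_iota //; exact: recfun_nth.
Qed.

Lemma recfun_mu O k (D : nat -> seq nat -> nat) :
  recfun O k.+1 (fun w => D (nth 0 w 0) (behead w)) ->
  (forall v, size v = k -> exists s, D s v = 0) ->
  exists2 g, recfun O k g & forall v, size v = k -> D (g v) v = 0.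
Proof.
move=> [c Hc] exD.
have exD' v : exists s, (size v == k) ==> (D s v == 0).
  case: (eqVneq (size v) k) => [/exD[s Ds]|]; last by exists 0.
  by exists s; apply/implyP => _; apply/eqP.
exists (fun v => ex_minn (exD' v)) => [|v sv].
  exists (Mu c) => v sv /=; case: ex_minnP => s; rewrite sv eqxx /= => /eqP Ds mins.
  split=> [|i hi]; first by have := Hc (s :: v); rewrite /= sv Ds; apply.
  exists (D i v).-1; have := Hc (i :: v); rewrite /= sv => /(_ erefl).
  case E: (D i v) => [|d] //.
  by have := mins i; rewrite E leqNgt hi /= => /(_ isT).
by case: ex_minnP => s; rewrite sv eqxx => /eqP.
Qed.

Definition recpred O k (p : seq nat -> bool) : Prop := recfun O k (fun v => p v : nat).

Section Closure.
Variables (O : set nat).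
Implicit Types (k : nat) (a b c : seq nat -> nat) (p q : seq nat -> bool).

Lemma recfun_add k a b : recfun O k a -> recfun O k b -> recfun O k (fun v => a v + b v).
Proof.
move=> Ha Hb.
apply: (@eq_recfun _ _ (fun v => primrec (a v) (b v) (fun _ r => r.+1))) => [v _|].
  by elim: (a v) => //= n ->.
by apply: recfun_primrec => //; apply/recfun_S/recfun_nth.
Qed.

Lemma recfun_mul k a b : recfun O k a -> recfun O k b -> recfun O k (fun v => a v * b v).
Proof.
move=> Ha Hb.
apply: (@eq_recfun _ _ (fun v => primrec (a v) 0 (fun _ r => b v + r))) => [v _|].
  by elim: (a v) => //= n ->; rewrite mulSn.
apply: (@recfun_primrec _ _ a (fun=> 0) (fun _ r v => b v + r)) => //.
  exact: recfun_const.
apply: recfun_add; last exact: recfun_nth.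
exact/(recfun_behead (f := fun w => b (behead w)))/recfun_behead.
Qed.

Lemma recfun_pred k a : recfun O k a -> recfun O k (fun v => (a v).-1).
Proof.
move=> Ha.
apply: (@eq_recfun _ _ (fun v => primrec (a v) 0 (fun i _ => i))) => [v _|].
  by case: (a v).
by apply: recfun_primrec; [| exact: recfun_const | exact: recfun_nth].
Qed.

Lemma recfun_sub k a b : recfun O k a -> recfun O k b -> recfun O k (fun v => a v - b v).
Proof.
move=> Ha Hb.
apply: (@eq_recfun _ _ (fun v => primrec (b v) (a v) (fun _ r => r.-1))) => [v _|].
  by elim: (b v) => [|n IH] /=; rewrite ?subn0 ?subnS ?IH.
by apply: recfun_primrec => //; exact/recfun_pred/recfun_nth.
Qed.

Lemma recfun_if k p a b : recpred O k p -> recfun O k a -> recfun O k b ->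
  recfun O k (fun v => if p v then a v else b v).
Proof.
move=> Hp Ha Hb.
apply: (@eq_recfun _ _ (fun v => p v * a v + (1 - p v) * b v)) => [v _|].
  by case: (p v); rewrite ?(mul1n, mul0n, addn0, add0n).
by do !apply: recfun_add => //; apply: recfun_mul => //; apply: recfun_sub => //;
  exact: recfun_const.
Qed.

Lemma recpred_not k p : recpred O k p -> recpred O k (fun v => ~~ p v).
Proof.
move=> Hp; apply: (@eq_recfun _ _ (fun v => 1 - p v)) => [v _|]; first by case: (p v).
by apply: recfun_sub => //; exact: recfun_const.
Qed.

Lemma recpred_and k p q : recpred O k p -> recpred O k q -> recpred O k (fun v =>
  p v && q v).
Proof.
move=> Hp Hq; apply: (@eq_recfun _ _ (fun v => p v * q v)) => [v _|].
  by case: (p v); case: (q v).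
exact: recfun_mul.
Qed.

Lemma recpred_or k p q : recpred O k p -> recpred O k q -> recpred O k (fun v => p v ||
  q v).
Proof.
move=> Hp Hq; apply: (@eq_recfun _ _ (fun v => ~~ (~~ p v && ~~ q v))) => [v _|].
  by case: (p v); case: (q v).
by apply/recpred_not/recpred_and; exact: recpred_not.
Qed.

Lemma recpred_imp k p q : recpred O k p -> recpred O k q -> recpred O k (fun v =>
  p v ==> q v).
Proof.
move=> Hp Hq; apply: (@eq_recfun _ _ (fun v => ~~ p v || q v)) => [v _|].
  by rewrite implybE.
exact/recpred_or/Hq/recpred_not.
Qed.

Lemma recpred_leq k a b : recfun O k a -> recfun O k b -> recpred O k (fun v =>
  a v <= b v).
Proof.
move=> Ha Hb; apply: (@eq_recfun _ _ (fun v => 1 - (a v - b v))) => [v _|].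
  by rewrite -subn_eq0; case: (a v - b v).
by apply: recfun_sub; [exact: recfun_const|exact: recfun_sub].
Qed.

Lemma recpred_eq k a b : recfun O k a -> recfun O k b -> recpred O k (fun v =>
  a v == b v).
Proof.
move=> Ha Hb; apply: (@eq_recfun _ _ (fun v => (a v <= b v) && (b v <= a v))) => [v _|].
  by rewrite eqn_leq.
by apply: recpred_and; exact: recpred_leq.
Qed.

Lemma recpred_eqb k p q : recpred O k p -> recpred O k q -> recpred O k (fun v =>
  p v == q v).
Proof.
move=> Hp Hq; apply: (@eq_recfun _ _ (fun v => (p v : nat) == (q v : nat))) => [v _|].
  by case: (p v); case: (q v).
exact: recpred_eq.
Qed.

Lemma recpred_odd k a : recfun O k a -> recpred O k (fun v => odd (a v)).
Proof.
move=> Ha; apply: (@eq_recfun _ _ (fun v => primrec (a v) 0 (fun _ r => 1 - r))) =>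
  [v _|].
  by elim: (a v) => //= n ->; case: odd.
by apply: recfun_primrec => //; [|apply: recfun_sub; [|exact: recfun_nth]];
  exact: recfun_const.
Qed.

Lemma recfun_half k a : recfun O k a -> recfun O k (fun v => (a v)./2).
Proof.
move=> Ha; apply: (@eq_recfun _ _ (fun v => primrec (a v) 0 (fun i r => odd i + r))) =>
  [v _|].
  by elim: (a v) => // n; rewrite [n.+1./2]uphalf_half => <-.
apply: recfun_primrec => //; first exact: recfun_const.
by apply: recfun_add; [apply: recpred_odd|]; exact: recfun_nth.
Qed.

Lemma recfun_exp2 k a : recfun O k a -> recfun O k (fun v => 2 ^ a v).
Proof.
move=> Ha; apply: (@eq_recfun _ _ (fun v => primrec (a v) 1 (fun i r => 2 * r))) =>
  [v _|].
  by elim: (a v) => // n; rewrite expnS => <-.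
apply: recfun_primrec => //; first exact: recfun_const.
by apply: recfun_mul; [exact: recfun_const|exact: recfun_nth].
Qed.

Lemma recfun_skip k (f : nat -> seq nat -> nat) :
  recfun O k.+1 (fun w => f (nth 0 w 0) (behead w)) ->
  recfun O k.+2 (fun w => f (nth 0 w 0) (behead (behead w))).
Proof.
move=> Hf; pose gs : seq (seq nat -> nat) :=
  (fun w => nth 0 w 0) :: mkseq (fun i w => nth 0 w i.+2) k.
pose F u := f (nth 0 u 0) (behead u).
apply: (@eq_recfun _ _ (fun w => F [seq g w | g <- gs])) => [v sv|].
  rewrite /F /= -map_comp; congr f.
  case: v sv => [|x [|y v]] //= [sv].
  apply: (@eq_from_nth _ 0); rewrite size_map size_iota // => i hi.
  by rewrite (nth_map 0) ?size_iota //= nth_iota.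
apply: (@recfun_subst _ _ F gs); first by rewrite /= size_map size_iota.
rewrite /= size_map size_iota => -[|i] hi /=; first exact: recfun_nth.
by rewrite (nth_map 0) ?size_iota // nth_iota //; exact: recfun_nth.
Qed.

(** The bound variable is prepended to the list of variables; all statements
    about quantifiers follow this convention. *)
Lemma recpred_all k n (p : nat -> seq nat -> bool) : recfun O k n ->
  recpred O k.+1 (fun w => p (nth 0 w 0) (behead w)) ->
  recpred O k (fun v => all (fun i => p i v) (iota 0 (n v))).
Proof.
move=> Hn Hp.
apply: (@eq_recfun _ _ (fun v => primrec (n v) 1 (fun i r => p i v && (r == 1)))) =>
  [v _|].
  elim: (n v) => // m IH.
  rewrite -addn1 iotaD all_cat addn1 [primrec _ _ _]/= IH eqb1 andbC.
  by rewrite [all _ (iota (0 + m) 1)]/= add0n andbT.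
apply: (@recfun_primrec _ _ n (fun=> 1) (fun i r v => p i v && (r == 1))) => //.
  exact: recfun_const.
apply: recpred_and; last by apply: recpred_eq; [exact: recfun_nth|exact: recfun_const].
exact: (recfun_skip (f := fun i v => p i v : nat)).
Qed.

Lemma recpred_has k n (p : nat -> seq nat -> bool) : recfun O k n ->
  recpred O k.+1 (fun w => p (nth 0 w 0) (behead w)) ->
  recpred O k (fun v => has (fun i => p i v) (iota 0 (n v))).
Proof.
move=> Hn Hp.
apply: (@eq_recfun _ _ (fun v => ~~ all (fun i => ~~ p i v) (iota 0 (n v)))) => [v _|].
  by rewrite -has_predC; congr nat_of_bool; apply: eq_has => i /=; rewrite negbK.
by apply/recpred_not/recpred_all => //; exact: recpred_not.
Qed.

Lemma recfun_count k n (p : nat -> seq nat -> bool) : recfun O k n ->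
  recpred O k.+1 (fun w => p (nth 0 w 0) (behead w)) ->
  recfun O k (fun v => count (fun i => p i v) (iota 0 (n v))).
Proof.
move=> Hn Hp.
apply: (@eq_recfun _ _ (fun v => primrec (n v) 0 (fun i r => p i v + r))) => [v _|].
  elim: (n v) => // m IH.
  rewrite -addn1 iotaD count_cat addn1 [primrec _ _ _]/= IH addnC.
  by rewrite [count _ (iota (0 + m) 1)]/= add0n addn0.
apply: (@recfun_primrec _ _ n (fun=> 0) (fun i r v => p i v + r)) => //.
  exact: recfun_const.
apply: recfun_add; last exact: recfun_nth.
exact: (recfun_skip (f := fun i v => p i v : nat)).
Qed.
End Closure.

(** * Finite sets as numbers *)

Fixpoint bit (s x : nat) : bool := if x is y.+1 then bit s./2 y else odd s.

(** The initial segment of length [s] of a characteristic function, as the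
    number whose binary digits it lists. Every number below [2 ^ s] is such a
    code, so a quantifier over finite sets is a bounded numerical one. *)
Fixpoint bitcode (p : pred nat) (s : nat) : nat :=
  if s is t.+1 then p 0 + (bitcode (fun x => p x.+1) t).*2 else 0.

Lemma bit_bitcode p s x : bit (bitcode p s) x = (x < s) && p x.
Proof.
elim: s p x => [|s IH] p x /=; first by elim: x => //=.
case: x => [|x] /=; first by rewrite oddD odd_double addbF oddb.
by rewrite half_bit_double IH ltnS.
Qed.

Lemma bitcode_lt p s : bitcode p s < 2 ^ s.
Proof.
elim: s p => //= s IH p; rewrite expnS mul2n.
apply: (@leq_trans (bitcode (fun x => p x.+1) s).+1.*2); last by rewrite leq_double.
by rewrite doubleS ltnS; case: (p 0); rewrite ?add1n ?add0n ?leqnSn.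
Qed.

Lemma bitcodeK s t : t < 2 ^ s -> bitcode (bit t) s = t.
Proof.
elim: s t => [|s IH] t; first by rewrite expn0 ltnS leqn0 => /eqP ->.
rewrite expnS mul2n => lt /=; rewrite IH ?odd_double_half //.
by rewrite -ltn_double (leq_ltn_trans _ lt) // -[leqRHS]odd_double_half leq_addl.
Qed.

Lemma eq_bitcode p q s : (forall x, x < s -> p x = q x) -> bitcode p s = bitcode q s.
Proof.
elim: s p q => //= s IH p q E; rewrite E // (IH _ (fun x => q x.+1)) // => x hx.
exact: E.
Qed.

Lemma bitcodeS p s : bitcode p s.+1 = bitcode p s + p s * 2 ^ s.
Proof.
elim: s p => [|s IH] p; first by rewrite /= muln1 addnC.
have E q t : bitcode q t.+1 = q 0 + (bitcode (fun x => q x.+1) t).*2 by [].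
by rewrite E IH doubleD addnA -E expnS mulnCA mul2n.
Qed.

Lemma recpred_bit O k a b : recfun O k a -> recfun O k b -> recpred O k (fun v =>
  bit (a v) (b v)).
Proof.
move=> Ha Hb.
apply: (@eq_recfun _ _ (fun v => odd (primrec (b v) (a v) (fun _ r => r./2)))) => [v _|].
  congr nat_of_bool; elim: (b v) (a v) => //= n IH a'; rewrite -IH; congr odd.
  by elim: n {IH} => //= n ->.
by apply/recpred_odd/recfun_primrec => //; exact/recfun_half/recfun_nth.
Qed.

(** * Turing reducibility *)

Lemma turing_leP A O : turing_le A O <-> recpred O 1 (fun v => nth 0 v 0 \in A).
Proof.
split=> -[c Hc]; exists c; first by move=> [|x [|]] //= _; exact: Hc.
by move=> n; have := Hc [:: n]; apply.
Qed.

Fixpoint oracle_subst (d c : code) : code :=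
  match c with
  | Oracle => Comp d [:: Proj 0]
  | Comp h gs => Comp (oracle_subst d h) (map (oracle_subst d) gs)
  | PrimRec g h => PrimRec (oracle_subst d g) (oracle_subst d h)
  | Mu g => Mu (oracle_subst d g)
  | _ => c
  end.

Lemma eval_oracle_subst A O d c : (forall n, eval O d [:: n] (n \in A)) ->
  forall v y, eval O (oracle_subst d c) v y <-> eval A c v y.
Proof.
move=> Hd; elim/code_nested_ind: c => //.
- move=> v y; split=> [/eval_CompP[w [sw Hw]]|->].
    case: w sw Hw => [|x [|//]] //= _ /(_ 0 isT) /= ->; rewrite nth0 => hy.
    exact: eval_fun hy (Hd _).
  apply/eval_CompP; exists [:: head 0 v]; last exact: Hd.
  by split=> // -[|] // _; rewrite /= nth0.
- move=> h gs IHh IHgs v y; split=> /eval_CompP[w [sw Hw] hw]; apply/eval_CompP;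
    rewrite ?size_map in sw Hw *; exists w; try exact/IHh; split=> // i hi.
  + by apply/(IHgs i hi); have := Hw i hi; rewrite (nth_map Zero).
  + by rewrite (nth_map Zero) //; exact/(IHgs i hi)/Hw.
- move=> g h IHg IHh v y; split=> -[s [s0 sS ys]]; exists s; split=> //;
    by [exact/IHg | move=> i hi; exact/IHh/sS].
- move=> g IHg v y; split=> -[y0 yl]; split=> [|i /yl[z]]; try exact/IHg;
    by move=> /IHg hz; exists z.
Qed.

Lemma recfun_le A O k f : turing_le A O -> recfun A k f -> recfun O k f.
Proof.
move=> [d Hd] [c Hc]; exists (oracle_subst d c) => v sv.
exact/(eval_oracle_subst _ Hd)/Hc.
Qed.

Lemma turing_le_refl A : turing_le A A.
Proof. by exists Oracle => n. Qed.

Lemma turing_le_trans B A C : turing_le A B -> turing_le B C -> turing_le A C.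
Proof. by move=> /turing_leP AB BC; apply/turing_leP; exact: recfun_le AB. Qed.

Lemma recpred_mem A O k a : turing_le A O -> recfun O k a -> recpred O k (fun v =>
  a v \in A).
Proof. by move=> /turing_leP AO Ha; apply: (recfun_subst1 (f := fun x =>
  x \in A : nat)). Qed.

Lemma mem_join A B n : (n \in turing_join A B) =
  if odd n then n./2 \in B else n./2 \in A.
Proof.
apply/idP/idP; rewrite in_setE.
- move=> [[m Am <-]|[m Bm <-]] /=; first by rewrite odd_double doubleK in_setE.
  by rewrite odd_double uphalf_double in_setE.
- case: ifP => on; rewrite in_setE => H; [right|left]; exists n./2 => //;
  by rewrite -[RHS](odd_double_half n) on.
Qed.

Lemma le_join_l A B : turing_le A (turing_join A B).
Proof.
apply/turing_leP; apply: (@eq_recfun _ _ (fun v =>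
  (nth 0 v 0 + nth 0 v 0) \in turing_join A B)).
  by move=> v _; rewrite mem_join addnn odd_double doubleK.
by apply: recpred_mem (turing_le_refl _) _; apply: recfun_add; exact: recfun_nth.
Qed.

Lemma le_join_r A B : turing_le B (turing_join A B).
Proof.
apply/turing_leP.
apply: (@eq_recfun _ _ (fun v => (nth 0 v 0 + nth 0 v 0).+1 \in turing_join A B)).
  by move=> v _; rewrite mem_join addnn /= odd_double /= uphalf_double.
apply: recpred_mem (turing_le_refl _) _; apply/recfun_S/recfun_add; exact: recfun_nth.
Qed.

Lemma le_join A B C : turing_le A C -> turing_le B C -> turing_le (turing_join A B) C.
Proof.
move=> AC BC; apply/turing_leP.
apply: (@eq_recfun _ _ (fun v => if odd (nth 0 v 0) then (nth 0 v 0)./2 \in B : nat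
   else (nth 0 v 0)./2 \in A)).
  by move=> v _; rewrite mem_join; case: ifP.
by apply: recfun_if; [apply: recpred_odd| |]; try apply: recpred_mem => //;
  try apply: recfun_half;
  exact: recfun_nth.
Qed.

(** * Step-bounded evaluation *)

(** Evaluation with searches bounded by [s] and oracle answers from [q]. The
    value 0 means that no result was found, and [y.+1] means the result [y];
    [q] uses the same convention for queries without an answer. *)
Fixpoint step_eval (s : nat) (q : nat -> nat) (c : code) (v : seq nat) : nat :=
  match c with
  | Zero => 1
  | Succ => (head 0 v).+2
  | Proj i => (nth 0 v i).+1
  | Oracle => q (head 0 v)
  | Comp h gs => let ws := [seq step_eval s q g v | g <- gs] in
      if all (leq 1) ws then step_eval s q h (map predn ws) else 0
  | PrimRec g h => primrec (head 0 v) (step_eval s q g (behead v))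
      (fun i r => if r == 0 then 0 else step_eval s q h [:: i, r.-1 & behead v])
  | Mu g => primrec s 0 (fun y r => if r != 0 then r else
      if (step_eval s q g (y :: v) == 1) && all (fun i =>
        1 < step_eval s q g (i :: v)) (iota 0 y)
      then y.+1 else 0)
  end.

Lemma step_eval_sound O s q c v y : (forall x z, q x = z.+1 -> z = (x \in O)) ->
  step_eval s q c v = y.+1 -> eval O c v y.
Proof.
move=> Hq; elim/code_nested_ind: c v y => /=.
- by move=> v y [<-].
- by move=> v y [<-].
- by move=> i v y [<-].
- by move=> v y /Hq.
- move=> h gs IHh IHgs v y; case: ifP => // /(all_nthP 0) al /IHh hw.
  apply/eval_CompP; eexists; last exact: hw.
  rewrite !size_map; split=> // i hi; apply: (IHgs i hi).
  rewrite (nth_map 0) ?size_map // prednK; last by apply: al; rewrite size_map.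
  by rewrite (nth_map Zero).
- move=> g h IHg IHh v y.
  pose s' i := (primrec i (step_eval s q g (behead v))
    (fun i r => if r == 0 then 0 else step_eval s q h [:: i, r.-1 & behead v])).
  rewrite -/(s' (head 0 v)) => E.
  have pos i : i <= head 0 v -> 0 < s' i.
    move=> hi; have : 0 < s' (head 0 v) by rewrite E.
    elim: (head 0 v) hi => [|n IH]; first by rewrite leqn0 => /eqP ->.
    rewrite leq_eqVlt => /orP[/eqP -> //|hi] H; apply: IH => //.
    by move: H; rewrite /s' /= -/(s' n); case: (s' n).
  exists (fun i => (s' i).-1); split; last by rewrite E.
    by apply: IHg; rewrite prednK // (pos 0).
  move=> i hi; apply: IHh; rewrite prednK ?pos //.
  by have := pos i (ltnW hi); rewrite /s' /= lt0n => /negPf ->.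
- move=> g IHg v y.
  suff H n : primrec n 0 (fun y r => if r != 0 then r else
      if (step_eval s q g (y :: v) == 1) && all (fun i =>
        1 < step_eval s q g (i :: v)) (iota 0 y)
      then y.+1 else 0) = y.+1 -> eval O g (y :: v) 0 /\
      forall i, i < y -> exists z, eval O g (i :: v) z.+1 by exact: H.
  elim: n => //= n IH; case: ifP => // _; case: ifP => // /andP[/eqP y0 /allP yl] [ny].
  rewrite ny in y0 yl; split; first exact: IHg.
  move=> i hi; have := yl i; rewrite mem_iota /= add0n => /(_ hi).
  case E: (step_eval s q g (i :: v)) => [|[|z]] // _; exists z; exact: IHg.
Qed.

Lemma step_eval_complete O (q : nat -> nat -> nat) c v y :
  (forall x, exists s0, forall s, s0 <= s -> q s x = (x \in O).+1) ->
  eval O c v y -> exists s0, forall s, s0 <= s -> step_eval s (q s) c v = y.+1.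
Proof.
move=> Hq; elim/code_nested_ind: c v y.
- by move=> v y /= ->; exists 0.
- by move=> v y /= ->; exists 0.
- by move=> i v y /= ->; exists 0.
- by move=> v y /= ->; exact: Hq.
- move=> h gs IHh IHgs v y /eval_CompP[w [sw Hw] /IHh[s1 H1]].
  have [s2 H2] : exists s0, forall s, s0 <= s ->
      [seq step_eval s (q s) g v | g <- gs] = map succn w.
    elim: gs w sw IHgs Hw {H1} => [|g gs IH] [|z w] //= sw IHgs Hw; first by exists 0.
    have [|s1' H1] := IHgs 0 isT v z; first exact: (Hw 0).
    have [|||s2 H2] := IH w; first by case: sw.
    + by move=> i hi; exact: (IHgs i.+1).
    + by move=> i hi; exact: (Hw i.+1).
    exists (maxn s1' s2) => s; rewrite geq_max => /andP[h1 h2].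
    by rewrite H1 // H2.
  exists (maxn s1 s2) => s; rewrite geq_max => /andP[h1 h2] /=.
  rewrite H2 // -map_comp map_id ?H1 //.
  by case: allP => // -[x /mapP[z _ ->]].
- move=> g h IHg IHh v y /= [t [t0 tS ->]].
  elim: (head 0 v) tS => [|n IH] tS; first exact: IHg t0.
  have [|s1 H1] := IH; first by move=> i hi; apply: tS; exact: ltnW.
  have [s2 H2] := IHh _ _ (tS n (ltnSn n)).
  exists (maxn s1 s2) => s; rewrite geq_max => /andP[h1 h2] /=.
  by rewrite H1 // H2.
- move=> g IHg v y /= [y0 yl].
  have [s1 H1] := IHg _ _ y0.
  have [s2 H2] : exists s0, forall s, s0 <= s -> forall i, i < y ->
    1 < step_eval s (q s) g (i :: v).
    elim: y yl {y0 H1} => [|y IH] yl; first by exists 0.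
    have [|s2 H2] := IH; first by move=> i hi; apply: yl; exact: ltnW.
    have [z /IHg[s3 H3]] := yl y (ltnSn y).
    exists (maxn s2 s3) => s; rewrite geq_max => /andP[h1 h2] i.
    rewrite ltnS leq_eqVlt => /orP[/eqP ->|]; first by rewrite H3.
    exact: H2.
  exists (maxn y.+1 (maxn s1 s2)) => s; rewrite !geq_max => /and3P[h0 h1 h2].
  set F := (fun _ => _).
  have low n : n <= y -> primrec n 0 F = 0.
    elim: n => // n IH hn /=; rewrite IH 1?ltnW // /F /=.
    by have := H2 s h2 n hn; case: eqP => // ->.
  have hit : primrec y.+1 0 F = y.+1.
    rewrite /= low // /F /= H1 // eqxx /=.
    case: allP => // -[i]; rewrite mem_iota /= add0n; exact: H2.
  rewrite -(subnK h0); elim: (s - y.+1) => // n IH.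
  by rewrite addSn /= -/(primrec (n + y.+1) 0 F) IH.
Qed.

(** Answers to queries about [turing_join B Y]: the even ones are put to [B], and
    the odd ones are read off a code [t] for [Y] below [s]. *)
Definition join_query (B : set nat) (s t x : nat) : nat :=
  if odd x then if x./2 < s then (bit t x./2).+1 else 0 else (x./2 \in B).+1.

(** The code is fixed, so an induction on it suffices. The list of arguments is
    a list of functions of a common context [w], because the induction has to
    pass from the arguments of a composition to those of its parts. *)
Lemma recfun_step_eval B c k a b (vs : seq (seq nat -> nat)) : recfun B k a ->
  recfun B k b ->
  (forall i, i < size vs -> recfun B k (nth (fun=> 0) vs i)) ->
  recfun B k (fun w => step_eval (a w) (join_query B (a w) (b w)) c [seq g w | g <- vs]).
Proof.
elim/code_nested_ind: c k a b vs => /=.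
- by move=> k a b vs *; exact: recfun_const.
- move=> k a b [|g vs] _ _ H /=; first exact: recfun_const.
  do 2 apply: recfun_S; exact: (H 0).
- move=> j k a b vs _ _ H; apply: recfun_S.
  have [hj|hj] := ltnP j (size vs).
    apply: eq_recfun (H j hj) => v _; by rewrite (nth_map (fun=> 0)).
  apply: eq_recfun (recfun_const _ _ 0) => v _; by rewrite nth_default // size_map.
- move=> k a b vs Ha Hb H.
  have Hx : recfun B k (fun w => head 0 [seq g w | g <- vs]).
    case: vs H => [|g vs] H /=; [exact: recfun_const | exact: (H 0)].
  rewrite /join_query; apply: recfun_if; first exact: recpred_odd.
    apply: recfun_if; last exact: recfun_const.
    - by apply: recpred_leq => //; apply/recfun_S/recfun_half.
    - by apply/recfun_S/recpred_bit => //; exact: recfun_half.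
  by apply/recfun_S/recpred_mem; [exact: turing_le_refl|exact: recfun_half].
- move=> h gs IHh IHgs k a b vs Ha Hb H.
  have Hg i : i < size gs -> recfun B k
      (fun w => step_eval (a w) (join_query B (a w) (b w)) (nth Zero gs i) [seq g w |
        g <- vs]).
    by move=> hi; exact: IHgs.
  apply: recfun_if; last exact: recfun_const.
    elim: gs {IHh IHgs} Hg => [|g gs IH] Hg /=; first exact: recfun_const.
    apply: recpred_and; first by apply: recpred_leq; [exact: recfun_const|exact: (Hg 0)].
    by apply: IH => i hi; exact: (Hg i.+1).
  pose vs' := [seq (fun w => (step_eval (a w) (join_query B (a w) (b w)) g [seq g w |
    g <- vs]).-1)
     | g <- gs].
  apply: (@eq_recfun _ _ (fun w => step_eval (a w) (join_query B (a w) (b w)) h [seq g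
    w | g <- vs'])).
    by move=> w _; rewrite /vs' -!map_comp.
  apply: IHh => //; rewrite size_map => i hi.
  by rewrite (nth_map Zero) //; apply: recfun_pred; exact: Hg.
- move=> g h IHg IHh k a b vs Ha Hb H.
  have Hx : recfun B k (fun w => head 0 [seq g w | g <- vs]).
    case: vs H => [|f vs] H /=; [exact: recfun_const | exact: (H 0)].
  apply: (@recfun_primrec _ _ _ (fun w => step_eval (a w) (join_query B (a w) (b w)) g
     (behead [seq g w | g <- vs])) (fun i r w => if r == 0 then 0 else
       step_eval (a w) (join_query B (a w) (b w)) h [:: i, r.-1 & behead [seq g w |
         g <- vs]])) => //.
    apply: (@eq_recfun _ _ (fun w => step_eval (a w) (join_query B (a w) (b w)) g
       [seq g w | g <- behead vs])); first by move=> w _; rewrite behead_map.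
    by apply: IHg => // i; rewrite size_behead nth_behead => hi; apply: H;
      case: (size vs) hi.
  apply: recfun_if; [by apply: recpred_eq; [exact: recfun_nth|exact: recfun_const]| |].
    exact: recfun_const.
  pose bb (w : seq nat) := behead (behead w).
  have Hbb f : recfun B k f -> recfun B k.+2 (fun w => f (bb w)).
    by move=> Hf; exact: (recfun_behead (recfun_behead Hf)).
  pose vs' : seq (seq nat -> nat) := [:: fun w => nth 0 w 0, fun w => (nth 0 w 1).-1 &
    [seq (fun w => f (bb w)) | f : seq nat -> nat <- behead vs]].
  apply: (@eq_recfun _ _ (fun w => step_eval (a (bb w)) (join_query B (a (bb w)) (b (bb
    w))) h
     [seq g w | g <- vs'])).
    by move=> w _; rewrite /vs' /= -map_comp behead_map.
  apply: IHh; [exact: Hbb|exact: Hbb|].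
  case=> [|[|i]] /=.
  + by move=> _; exact: recfun_nth.
  + by move=> _; exact/recfun_pred/recfun_nth.
  + rewrite size_map !ltnS => hi; rewrite (nth_map (fun=> 0)) //; apply: Hbb.
    by move: hi; rewrite size_behead nth_behead => hi; apply: H; case: (size vs) hi.
- move=> g IHg k a b vs Ha Hb H.
  pose G i w := step_eval (a w) (join_query B (a w) (b w)) g (i :: [seq f w | f <- vs]).
  have HG : recfun B k.+1 (fun w => G (nth 0 w 0) (behead w)).
    pose vs' : seq (seq nat -> nat) :=
      (fun w => nth 0 w 0) :: [seq (fun w => f (behead w)) | f : seq nat -> nat <- vs].
    apply: (@eq_recfun _ _ (fun w => step_eval (a (behead w)) (join_query B (a (behead
      w)) (b (behead w))) g
       [seq g w | g <- vs'])); first by move=> w _; rewrite /vs' /= -map_comp.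
    apply: IHg; [exact: recfun_behead|exact: recfun_behead|].
    case=> [|i] /=.
      by move=> _; exact: recfun_nth.
    by rewrite size_map ltnS => hi; rewrite (nth_map (fun=> 0)) //; apply/recfun_behead/H.
  apply: (@recfun_primrec _ _ a (fun=> 0) (fun y r w => if r != 0 then r else
     if (G y w == 1) && all (fun i => 1 < G i w) (iota 0 y) then y.+1 else 0)) => //.
    exact: recfun_const.
  apply: recfun_if; [by apply/recpred_not/recpred_eq;
    [exact: recfun_nth|exact: recfun_const]| |].
    exact: recfun_nth.
  apply: recfun_if; [|exact/recfun_S/recfun_nth|exact: recfun_const].
  apply: recpred_and; first by apply: recpred_eq;
    [exact: recfun_skip|exact: recfun_const].
  apply: (@recpred_all _ _ _ (fun i w => 1 < G i (behead (behead w))));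
    first exact: recfun_nth.
  apply: recpred_leq; first exact: recfun_const.
  exact: (recfun_skip (f := fun i w => G i (behead w)) (recfun_skip HG)).
Qed.

Definition initseg (Y : set nat) (s : nat) : nat := bitcode (fun x => x \in Y) s.

(** The number of steps ranges up to [s] to make convergence monotone in [s];
    with exactly [s] steps this would need a separate induction on codes. *)
Definition converges (B : set nat) (c : code) (n i s t : nat) : bool :=
  has (fun r => step_eval r (join_query B r t) c [:: n] == i.+1) (iota 0 s.+1).

Lemma bit_initseg Y s x : bit (initseg Y s) x = (x < s) && (x \in Y).
Proof. exact: bit_bitcode. Qed.

Lemma join_query_initseg B Y s r : r <= s -> join_query B r (initseg Y s) = join_query
  B r (initseg Y r).
Proof.
move=> rs; apply/funext => x; rewrite /join_query; case: ifP => // _; case: ifP => // xr.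
by rewrite !bit_initseg xr (leq_trans xr rs).
Qed.

Lemma convergesP B c n i s Y : reflect
  (exists2 r, r <= s & step_eval r (join_query B r (initseg Y r)) c [:: n] = i.+1)
    (converges B c n i s (initseg Y s)).
Proof.
apply: (iffP hasP) => [[r]|[r rs E]].
  rewrite mem_iota ltnS /= => rs; rewrite join_query_initseg // => /eqP; by exists r.
by exists r; [rewrite mem_iota ltnS | rewrite join_query_initseg // E].
Qed.

Lemma converges_mono B c n i Y s t : s <= t ->
  converges B c n i s (initseg Y s) -> converges B c n i t (initseg Y t).
Proof.
move=> st /convergesP[r rs E]; apply/convergesP; exists r => //; exact: leq_trans st.
Qed.

Lemma converges_eval B c n i Y s :
  converges B c n i s (initseg Y s) -> eval (turing_join B Y) c [:: n] i.
Proof.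
move=> /convergesP[r _ E]; apply: step_eval_sound E => x z; rewrite /join_query mem_join.
case: ifP => _; last by case.
by case: ifP => // xr [<-]; rewrite bit_initseg xr.
Qed.

Lemma eval_converges B c n i Y : eval (turing_join B Y) c [:: n] i ->
  exists s, converges B c n i s (initseg Y s).
Proof.
move=> /(step_eval_complete (q := fun s => join_query B s (initseg Y s)))[|s0 H0].
  move=> x; exists x.+1 => s xs; rewrite /join_query mem_join; case: ifP => // ox.
  have xs' : x./2 < s by apply: leq_ltn_trans xs;
    rewrite leq_half_double -addnn leqW ?leq_addr.
  by rewrite bit_initseg xs'.
by exists s0; apply/convergesP; exists s0 => //; exact: H0.
Qed.

Lemma recpred_converges B O c k n i s t : turing_le B O -> recfun O k n -> recfun O k i ->
  recfun O k s -> recfun O k t -> recpred O k (fun v =>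
    converges B c (n v) (i v) (s v) (t v)).
Proof.
move=> BO; apply: (recfun_subst4 (f := fun n i s t => converges B c n i s t)).
apply: recfun_le BO _; apply: (@recpred_has _ _ (fun v => (nth 0 v 2).+1)
   (fun r v => step_eval r (join_query B r (nth 0 v 3)) c [:: nth 0 v 0] == (nth 0 v
     1).+1)).
  exact/recfun_S/recfun_nth.
have nb j : recfun B 5 (fun w => nth 0 (behead w) j).
  by exact: (recfun_behead (f := fun w => nth 0 w j) (recfun_nth _ _ _)).
apply: recpred_eq; last by apply: recfun_S.
apply: (@recfun_step_eval _ _ _ (fun w => nth 0 w 0) (fun w => nth 0 (behead w) 3)
  [:: fun w => nth 0 (behead w) 0]) => //; first exact: recfun_nth.
case=> // _; exact: nb.
Qed.

(** * Effectively closed classes and the cone *)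

Lemma mem_set_pred (p : pred nat) x : (x \in [set y | p y]) = p x.
Proof. by apply/idP/idP; rewrite in_setE. Qed.

Lemma eq_initseg X Y s : (forall x, x < s -> (x \in X) = (x \in Y)) ->
  initseg X s = initseg Y s.
Proof. exact: eq_bitcode. Qed.

Lemma initseg_bits s t : t < 2 ^ s -> initseg [set x | bit t x] s = t.
Proof.
move=> lt; rewrite -[RHS](bitcodeK lt); apply: eq_bitcode => x _; exact: mem_set_pred.
Qed.

Lemma all_initsegP (p : pred nat) s :
  reflect (forall Y, p (initseg Y s)) (all p (iota 0 (2 ^ s))).
Proof.
apply: (iffP allP) => [H Y|H t]; first by apply: H; rewrite mem_iota; exact: bitcode_lt.
by rewrite mem_iota => /initseg_bits <-.
Qed.

Lemma dep_choice (T : Type) (R : nat -> T -> T -> Prop) (x0 : T) :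
  (forall n x, exists y, R n x y) ->
  exists u : nat -> T, u 0 = x0 /\ forall n, R n (u n) (u n.+1).
Proof.
move=> H; have [f Hf] := choice (fun nx : nat * T => H nx.1 nx.2).
pose u := fix u n := if n is m.+1 then f (m, u m) else x0.
by exists u; split=> // n; exact: (Hf (n, u n)).
Qed.

(** The set is decided one point at a time. A prefix is good when it has
    extensions in [T] of every length; if both extensions of a good prefix by
    one digit failed, then by monotonicity they would fail at a common length. *)
Lemma konig (T : nat -> nat -> Prop) :
  (forall s t Y, s <= t -> T t (initseg Y t) -> T s (initseg Y s)) ->
  (forall s, exists Y, T s (initseg Y s)) -> exists Y, forall s, T s (initseg Y s).
Proof.
move=> Tm Tinf.
pose good l (Y : set nat) := forall s, l <= s ->
  exists2 Y' : set nat, (forall x, x < l -> Y' x = Y x) & T s (initseg Y' s).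
have good0 : good 0 set0 by move=> s _; have [Y' HY'] := Tinf s; exists Y'.
have goodS l Y : exists Y', good l Y -> good l.+1 Y' /\ forall x, x < l -> Y' x = Y x.
  have [gY|ngY] := pselect (good l Y); last by exists Y => /ngY.
  pose Yb (b : bool) : set nat := fun x => if x == l then b : Prop else Y x.
  have YbE b x : x < l -> Yb b x = Y x by rewrite /Yb; case: eqVneq => // ->;
    rewrite ltnn.
  have [gb|nb] := pselect (exists b, good l.+1 (Yb b)).
    by have [b gb'] := gb; exists (Yb b) => _; split=> // x; exact: YbE.
  have [bad Hbad] : exists f : bool -> nat, forall b, l.+1 <= f b /\
      ~ exists2 Y' : set nat, (forall x, x < l.+1 -> Y' x = Yb b x) &
        T (f b) (initseg Y' (f b)).
    have H b : exists s, l.+1 <= s /\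
      ~ exists2 Y' : set nat, (forall x, x < l.+1 -> Y' x = Yb b x) & T s (initseg Y' s).
      have : ~ good l.+1 (Yb b) by move=> H; apply: nb; exists b.
      by move=> /existsNP[s /not_implyP[ls Hs]]; exists s.
    by have [f Hf] := choice H; exists f.
  have [Y' Y'Y HY'] := gY (maxn (bad true) (bad false))
    (leq_trans (leq_trans (leqnSn l) (Hbad true).1) (leq_maxl _ _)).
  exfalso; have [_] := Hbad (l \in Y'); apply; exists Y'.
    move=> x; rewrite ltnS leq_eqVlt /Yb; case: eqVneq => [->|_ /= xl];
      first by rewrite in_setE.
    exact: Y'Y.
  by apply: Tm HY'; case: (l \in Y'); rewrite ?leq_maxl ?leq_maxr.
have [u [u0 uS]] := @dep_choice _ (fun l Y Y' => good l Y ->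
  good l.+1 Y' /\ forall x, x < l -> Y' x = Y x) set0 goodS.
have gu l : good l (u l).
  elim: l => [|l IH]; first by rewrite u0.
  by have [] := uS l IH.
have ul l m x : x < l -> l <= m -> u m x = u l x.
  move=> xl; elim: m => [|m IH]; first by rewrite leqn0 => /eqP <-.
  rewrite leq_eqVlt => /orP[/eqP <- //|lm]; rewrite -IH //.
  by have [_] := uS m (gu m); apply; exact: leq_trans xl _.
exists (fun x => u x.+1 x) => s.
have [Y' Y'u] := gu s s (leqnn s); congr (T s); apply: eq_initseg => x xs.
by apply/idP/idP; rewrite !in_setE Y'u // -(ul x.+1 s).
Qed.

Definition avoids (W O : set nat) : Prop := ~ turing_le W O.

Lemma avoids_le W O O' : turing_le O' O -> avoids W O -> avoids W O'.
Proof. by move=> le' av /turing_le_trans /(_ le'). Qed.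

(** Otherwise [D n i] has a witness exactly when [i] is the value of [W] at [n],
    for both truth values, and a search for a witness of [D n 0] or [D n 1]
    computes [W]. *)
Lemma enum_or_miss W O (D : nat -> nat -> nat -> bool) : avoids W O ->
  recpred O 3 (fun v => D (nth 0 v 0) (nth 0 v 1) (nth 0 v 2)) ->
  exists n, (exists s, D n (n \notin W) s) \/ (forall s, ~~ D n (n \in W) s).
Proof.
move=> av Dd; apply: contrapT => /forallNP H; apply: av.
have H0 n s : ~~ D n (n \notin W) s.
  by apply/negP => Ds; apply: (H n); left; exists s.
have H1 n : exists s, D n (n \in W) s.
  apply: contrapT => /forallNP K; apply: (H n); right => s; apply/negP; exact: K.
pose E s v := ~~ (D (nth 0 v 0) 0 s || D (nth 0 v 0) 1 s) : nat.
have Dc k n i s : recfun O k n -> recfun O k i -> recfun O k s ->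
  recpred O k (fun v => D (n v) (i v) (s v)).
  exact: (recfun_subst3 (f := fun n i s => D n i s)).
have [||g gc gE] := @recfun_mu O 1 E.
- apply/recpred_not/recpred_or; apply: Dc; try exact: recfun_nth; try exact: recfun_const;
  exact: (recfun_behead (f := fun v => nth 0 v 0) (recfun_nth _ _ _)).
- move=> v _; have [s Hs] := H1 (nth 0 v 0); exists s; rewrite /E.
  by move: Hs; case: (_ \in W) => ->; rewrite ?orbT.
apply/turing_leP.
apply: (@eq_recfun _ _ (fun v => D (nth 0 v 0) 1 (g v))); last first.
  by apply: Dc => //; [exact: recfun_nth|exact: recfun_const].
move=> v sv; have := gE v sv; rewrite /E; case: orP => // DD _.
have := H0 (nth 0 v 0) (g v); case: (_ \in W) => /=; last by move=> /negPf ->.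
by case: DD => ->.
Qed.

Definition segment_monotone (P : nat -> nat -> bool) : Prop :=
  forall s t Y, s <= t -> P t (initseg Y t) -> P s (initseg Y s).

(** The class of all [X] with [P s (X below s)] for every [s]; by
    compactness the last field says that it is not empty. *)
Record pi01 (O : set nat) := Pi01 {
  pred_of :> nat -> nat -> bool;
  pi01_rec : recpred O 2 (fun v => pred_of (nth 0 v 0) (nth 0 v 1));
  pi01_mono : segment_monotone pred_of;
  pi01_inf : forall s, exists Y, pred_of s (initseg Y s) }.

(** Ask whether the class has a bounded proof that the functional [c] converges
    to a given value on all its members. If some wrong value has such a proof,
    the class needs no change; if the correct value has none, restrict
    the class to the members on which it is not attained. *)
Lemma pi01_decide W O (P : pi01 O) c : avoids W O -> exists2 Q : pi01 O,
  (forall s t, Q s t -> P s t) & exists n, forall X,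
    (forall s, Q s (initseg X s)) -> ~ eval (turing_join O X) c [:: n] (n \in W).
Proof.
move=> av.
pose D n i s := all (fun t => ~~ (P s t && ~~ converges O c n i s t)) (iota 0 (2 ^ s)).
have Pc k s t : recfun O k s -> recfun O k t -> recpred O k (fun v => P (s v) (t v)).
  exact: (recfun_subst2 (f := fun s t => P s t) (pi01_rec P)).
have [|n [[s Ds]|Dn]] := enum_or_miss (D := D) av.
- apply: (@recpred_all _ _ (fun v => 2 ^ nth 0 v 2) (fun t v =>
    ~~ (P (nth 0 v 2) t && ~~ converges O c (nth 0 v 0) (nth 0 v 1) (nth 0 v 2) t))).
    exact/recfun_exp2/recfun_nth.
  have nb j : recfun O 4 (fun w => nth 0 (behead w) j).
    exact: (recfun_behead (f := fun w => nth 0 w j) (recfun_nth _ _ _)).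
  apply/recpred_not/recpred_and; first by apply: Pc => //; exact: recfun_nth.
  by apply/recpred_not/recpred_converges => //; [exact: turing_le_refl|exact: recfun_nth].
- exists P => //; exists n => X PX eX.
  have /all_initsegP /(_ X) := Ds; rewrite PX /= negbK => /converges_eval eX'.
  by have := eval_fun eX eX'; case: (n \in W).
- have Qdec : recpred O 2 (fun v => P (nth 0 v 0) (nth 0 v 1) &&
      ~~ converges O c n (n \in W) (nth 0 v 0) (nth 0 v 1)).
    apply: recpred_and; first by apply: Pc; exact: recfun_nth.
    apply/recpred_not/recpred_converges; try exact: recfun_nth; try exact: recfun_const.
    exact: turing_le_refl.
  have Qmono : segment_monotone (fun s t => P s t && ~~ converges O c n (n \in W) s t).
    move=> s t Y st /andP[/(pi01_mono st) -> /=].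
    by apply: contra => /(converges_mono st).
  have Qinf s : exists Y, P s (initseg Y s) && ~~ converges O c n (n \in W) s (initseg
    Y s).
    have := Dn s; rewrite /D -has_predC => /hasP[t].
    rewrite mem_iota /= negbK => lt Pt; exists [set x | bit t x].
    by rewrite initseg_bits.
  exists (Pi01 Qdec Qmono Qinf) => /= [s t /andP[] //|].
  exists n => X QX /eval_converges[s sconv]; by have := QX s; rewrite sconv andbF.
Qed.

(** Iterate [pi01_decide] over all codes and take a common member of the
    decreasing sequence of classes. *)
Lemma cone_avoiding_basis W O (P : pi01 O) : avoids W O ->
  exists2 X, (forall s, P s (initseg X s)) & avoids W (turing_join O X).
Proof.
move=> av.
have [|u [u0 uS]] := @dep_choice _ (fun k (P Q : pi01 O) =>
  (forall s t, Q s t -> P s t) /\ exists n, forall X, (forall s, Q s (initseg X s)) ->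
    ~ eval (turing_join O X) (nth_code k) [:: n] (n \in W)) P.
  by move=> k Q; have [R RQ HR] := pi01_decide Q (nth_code k) av; exists R.
have sub k m s t : k <= m -> u m s t -> u k s t.
  elim: m => [|m IH]; first by rewrite leqn0 => /eqP ->.
  rewrite leq_eqVlt => /orP[/eqP -> //|km] /(uS m).1; exact: IH.
have [|s|X HX] := @konig (fun s t => u s s t).
- by move=> s t Y st /(sub _ _ _ _ st) /(pi01_mono st).
- exact: pi01_inf.
have HX' k s : u k s (initseg X s).
  case: (leqP k s) => [ks|/ltnW sk]; first exact: sub (HX s).
  exact: pi01_mono (HX k).
exists X => [s|[c Hc]]; first by rewrite -u0.
have [k ck] := nth_code_surj c.
have [_ [n Hn]] := uS k; apply: (Hn X) => //.
by rewrite ck; exact: Hc.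
Qed.

(** The form in which the basis theorem is applied by the forcings: [P n i] is a
    class of objects that prevent the value [i] at [n]. Either no object
    prevents some wrong value, or some object, itself avoiding the cone,
    prevents a correct one. *)
Lemma tree_dichotomy W O (P : nat -> nat -> nat -> nat -> bool) : avoids W O ->
  recpred O 4 (fun v => P (nth 0 v 0) (nth 0 v 1) (nth 0 v 2) (nth 0 v 3)) ->
  (forall n i, segment_monotone (P n i)) ->
  (exists n s, forall X, ~~ P n (n \notin W) s (initseg X s)) \/
  (exists n X, (forall s, P n (n \in W) s (initseg X s)) /\ avoids W (turing_join O X)).
Proof.
move=> av Pd Pm.
pose D n i s := all (fun t => ~~ P n i s t) (iota 0 (2 ^ s)).
have Pc k n i s t : recfun O k n -> recfun O k i -> recfun O k s -> recfun O k t ->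
  recpred O k (fun v => P (n v) (i v) (s v) (t v)).
  exact: (recfun_subst4 (f := fun n i s t => P n i s t)).
have [|n [[s /all_initsegP Ds]|Dn]] := enum_or_miss (D := D) av.
- apply: (@recpred_all _ _ (fun v => 2 ^ nth 0 v 2) (fun t v =>
    ~~ P (nth 0 v 0) (nth 0 v 1) (nth 0 v 2) t)); first exact/recfun_exp2/recfun_nth.
  have nb j : recfun O 4 (fun w => nth 0 (behead w) j).
    exact: (recfun_behead (f := fun w => nth 0 w j) (recfun_nth _ _ _)).
  by apply/recpred_not/Pc => //; exact: recfun_nth.
- by left; exists n, s.
- have Pdn : recpred O 2 (fun v => P n (n \in W) (nth 0 v 0) (nth 0 v 1)).
    by apply: Pc; try exact: recfun_nth; exact: recfun_const.
  have Pinf s : exists Y, P n (n \in W) s (initseg Y s).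
    have := Dn s; rewrite /D -has_predC => /hasP[t].
    rewrite mem_iota /= negbK => lt Pt; exists [set x | bit t x].
    by rewrite initseg_bits.
  have [X PX aX] := cone_avoiding_basis (Pi01 Pdn (Pm n _) Pinf) av.
  by right; exists n, X.
Qed.

(** * Forcing with stems *)

Definition unbounded (Y : set nat) : Prop := forall n, exists2 x, n <= x & x \in Y.

Section Forcing.
Variables (W B : set nat) (T : Type) (le : T -> T -> Prop).
Variables (stem : T -> set nat) (len : T -> nat).

(** A wrong value persists in every extension because its use is below
    [len q]. *)
Definition decides (c : code) (q : T) : Prop := exists n,
  converges B c n (n \notin W) (len q) (initseg (stem q) (len q)) \/
  forall r, le r q -> ~~ converges B c n (n \in W) (len r) (initseg (stem r) (len r)).

(** The common part of all constructions. Density is only asked for below [p0],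
    so that [blocked] can turn a failure of the construction into a condition
    below a prescribed one. *)
Lemma mathias_forcing (Dn : nat -> T -> Prop) (p0 : T) :
  (forall p, le p p) -> (forall p q r, le q p -> le r q -> le r p) ->
  (forall p q, le q p -> len p <= len q /\
     forall x, x < len p -> (x \in stem q) = (x \in stem p)) ->
  (forall p, le p p0 ->
     exists2 q, le q p & exists2 x, len p <= x < len q & x \in stem q) ->
  (forall n p, le p p0 -> exists2 q, le q p & Dn n q) ->
  (forall c p, le p p0 -> exists2 q, le q p & decides c q) ->
  exists (u : nat -> T) (Y : set nat), [/\ u 0 = p0 /\ (forall n m, n <= m ->
    le (u m) (u n)),
    forall n, n <= len (u n) /\ forall x, x < len (u n) -> (x \in Y) = (x \in stem (u n)),
    unbounded Y, avoids W (turing_join B Y) & forall n, Dn n (u n.+1)].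
Proof.
move=> lexx letr leE grow dense dec'.
have [|u [u0 uR]] := @dep_choice _ (fun k p q => le p p0 -> [/\ le q p, Dn k q,
    decides (nth_code k) q & exists2 x, len p <= x < len q & x \in stem q]) p0.
  move=> k p; have [pp0|] := pselect (le p p0); last by exists p.
  have [q1 q1p Dq1] := dec' (nth_code k) p pp0.
  have q1p0 := letr _ _ _ pp0 q1p.
  have [q2 q2q1 [x /andP[x1 x2] xq2]] := grow q1 q1p0.
  have [q3 q3q2 Dq3] := dense k q2 (letr _ _ _ q1p0 q2q1).
  have [l1 _] := leE _ _ q1p; have [l3 E3] := leE _ _ q3q2.
  have [l2 E2] := leE _ _ q2q1.
  exists q3; split=> //; first exact: (letr _ _ _ (letr _ _ _ q1p q2q1) q3q2).
    have [n [Hn|Hn]] := Dq1; exists n; [left|right] => [|r rq3].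
      have E x' : x' < len q1 -> (x' \in stem q1) = (x' \in stem q3).
        by move=> x'l; rewrite E3 1?E2 // (leq_trans x'l).
      apply: (converges_mono (leq_trans l2 l3)); by rewrite -(eq_initseg E).
    by apply: Hn; apply: (letr _ _ _ q2q1); exact: (letr _ _ _ q3q2).
  exists x; first by rewrite (leq_trans l1 x1) (leq_trans x2 l3).
  by rewrite E3.
have up0 n : le (u n) p0.
  by elim: n => [|n IH]; rewrite ?u0 //; have [/(letr _ _ _ IH)] := uR n IH.
have uS n := uR n (up0 n).
have ule n m : n <= m -> le (u m) (u n).
  elim: m => [|m IH]; first by rewrite leqn0 => /eqP ->.
  rewrite leq_eqVlt => /orP[/eqP -> //|nm]; have [um _ _ _] := uS m.
  by apply: (letr _ _ _ (IH _) um).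
have lenS n : len (u n) < len (u n.+1).
  have [_ _ _ [x /andP[x1 x2] _]] := uS n; exact: leq_ltn_trans x2.
have len_ge n : n <= len (u n) by elim: n => // n IH; exact: leq_ltn_trans (lenS n).
pose Y : set nat := [set x | x \in stem (u x.+1)].
have YE n x : x < len (u n) -> (x \in Y) = (x \in stem (u n)).
  move=> xn; have -> : (x \in Y) = (x \in stem (u x.+1)).
    exact: (mem_set_pred (fun x => x \in stem (u x.+1))).
  case: (leqP n x.+1) => nx; last first.
    by have [_ ->] := leE _ _ (ule _ _ (ltnW nx)).
  by have [_ ->] := leE _ _ (ule _ _ nx).
exists u, Y; split=> //.
- by move=> n; split=> [|x xn]; [exact: len_ge|exact: YE].
- move=> n; have [_ _ _ [x /andP[x1 x2] xs]] := uS n.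
  by exists x; [exact: leq_trans x1|rewrite (YE n.+1)].
- rewrite /avoids => -[c Hc]; have [k ck] := nth_code_surj c.
  have [_ _ [n [Hn|Hn]] _] := uS k; rewrite ck in Hn.
    rewrite -(eq_initseg (YE k.+1)) in Hn.
    by have := eval_fun (Hc n) (converges_eval Hn); case: (n \in W).
  have [s Hs] := eval_converges (Hc n).
  pose m := maxn s k.+1.
  have /negP := Hn (u m) (ule _ _ (leq_maxr _ _)); apply.
  rewrite -(eq_initseg (YE m)); apply: converges_mono Hs.
  exact: leq_trans (leq_maxl _ _) (len_ge m).
- by move=> n; have [] := uS n.
Qed.
End Forcing.

(** * Mathias conditions with cone-avoiding reservoirs *)

Lemma turing_le_bounded F l O : (forall x, x \in F -> x < l) -> turing_le F O.
Proof.
move=> Fl; apply/turing_leP.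
apply: (@eq_recfun _ _ (fun v => bit (initseg F l) (nth 0 v 0))).
  by move=> v _; rewrite bit_initseg; case: (boolP (_ \in F)) => [/Fl ->|];
    rewrite ?andbF.
by apply: recpred_bit; [exact: recfun_const|exact: recfun_nth].
Qed.

Lemma turing_le_recpred (p : pred nat) O : recpred O 1 (fun v => p (nth 0 v 0)) ->
  turing_le [set x | p x] O.
Proof.
by move=> H; apply/turing_leP; apply: eq_recfun H => v _; rewrite mem_set_pred.
Qed.

Definition cut (s : nat) (A : set nat) : set nat := [set x | (s <= x) && (x \in A)].
Definition trunc (Y : set nat) (s : nat) : set nat := [set x | (x < s) && (x \in Y)].

Lemma mem_cut s A x : (x \in cut s A) = (s <= x) && (x \in A).
Proof. exact: (mem_set_pred (fun x => (s <= x) && (x \in A))). Qed.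

Lemma mem_trunc Y s x : (x \in trunc Y s) = (x < s) && (x \in Y).
Proof. exact: (mem_set_pred (fun x => (x < s) && (x \in Y))). Qed.

Lemma initseg_trunc Y s : initseg (trunc Y s) s = initseg Y s.
Proof. by apply: eq_initseg => x xs; rewrite mem_trunc xs. Qed.

Lemma turing_le_cut s A O : turing_le A O -> turing_le (cut s A) O.
Proof.
move=> AO; apply: turing_le_recpred; apply: recpred_and.
  by apply: recpred_leq; [exact: recfun_const|exact: recfun_nth].
by apply: recpred_mem => //; exact: recfun_nth.
Qed.

Lemma unbounded_cut s A : unbounded A -> unbounded (cut s A).
Proof.
move=> uA n; have [x xn xA] := uA (maxn n s); move: xn; rewrite geq_max => /andP[nx sx].
by exists x => //; rewrite mem_cut sx.
Qed.

Section Conditions.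
Variables (W B : set nat).

(** The oracle [orc] may be stronger than the reservoir: it also has to compute
    the promises that are attached to conditions later. *)
Record cond := Cond {
  stem : set nat; len : nat; res : set nat; orc : set nat;
  stem_len : forall x, x \in stem -> x < len;
  res_len : forall x, x \in res -> len <= x;
  res_unb : unbounded res;
  base_orc : turing_le B orc;
  res_orc : turing_le res orc;
  orc_av : avoids W orc }.

Definition cond_le (q p : cond) : Prop :=
  [/\ len p <= len q,
      forall x, x < len p -> (x \in stem q) = (x \in stem p),
      forall x, len p <= x -> x \in stem q -> x \in res p,
      forall x, x \in res q -> x \in res p
    & turing_le (orc p) (orc q)].

Lemma cond_le_refl p : cond_le p p.
Proof.
split=> //; last exact: turing_le_refl.
by move=> x lx /stem_len; rewrite ltnNge lx.
Qed.

Lemma cond_le_trans p q r : cond_le q p -> cond_le r q -> cond_le r p.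
Proof.
move=> [l1 s1 t1 r1 o1] [l2 s2 t2 r2 o2]; split=> //.
- exact: leq_trans l2.
- by move=> x xl; rewrite s2 ?s1 // (leq_trans xl).
- move=> x xl xr; case: (ltnP x (len q)) => xq; first by apply: t1; rewrite -?s2.
  exact/r1/t2.
- by move=> x /r2/r1.
- exact: turing_le_trans o2.
Qed.

Lemma cond_le_len p q : cond_le q p -> len p <= len q /\
  forall x, x < len p -> (x \in stem q) = (x \in stem p).
Proof. by case. Qed.

Definition admissible (l : nat) (F : set nat) (A : pred nat) (s t : nat) : bool :=
  (l <= s) && all (fun x => if x < l then bit t x == (x \in F) else bit t x ==> A x)
    (iota 0 s).

Lemma admissibleP l F (A : pred nat) s Y : reflect (l <= s /\ forall x, x < s ->
  if x < l then (x \in Y) = (x \in F) else x \in Y ->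
    A x) (admissible l F A s (initseg Y s)).
Proof.
apply: (iffP andP) => -[ls H]; split=> //.
- move=> x xs; have /allP/(_ x) := H; rewrite mem_iota /= bit_initseg xs => /(_ isT).
  by case: ifP => _; [move=> /eqP|move=> /implyP].
- apply/allP => x; rewrite mem_iota /= add0n bit_initseg => xs; rewrite xs /=.
  by have := H x xs; case: ifP => _; [move=> ->|move=> K; apply/implyP].
Qed.

Lemma recpred_admissible O k l F (A : nat -> seq nat -> bool) s t :
  (forall x, x \in F -> x < l) ->
  recpred O k.+1 (fun w => A (nth 0 w 0) (behead w)) -> recfun O k s -> recfun O k t ->
  recpred O k (fun v => admissible l F (A^~ v) (s v) (t v)).
Proof.
move=> Fl HA Hs Ht; apply: recpred_and; first by apply: recpred_leq => //;
  exact: recfun_const.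
apply: (@recpred_all _ _ _ (fun x v => if x < l then bit (t v) x == (x \in F)
   else bit (t v) x ==> A x v)) => //.
have Hb : recpred O k.+1 (fun w => bit (t (behead w)) (nth 0 w 0)).
  by apply: recpred_bit; [exact: recfun_behead|exact: recfun_nth].
apply: (@eq_recfun _ _ (fun w => if nth 0 w 0 < l
   then (bit (t (behead w)) (nth 0 w 0) == (nth 0 w 0 \in F)) : nat
   else (bit (t (behead w)) (nth 0 w 0) ==> A (nth 0 w 0) (behead w)))).
  by move=> w _; case: ifP.
apply: recfun_if.
- by apply: recpred_leq; [exact/recfun_S/recfun_nth|exact: recfun_const].
- by apply: recpred_eqb => //; apply: recpred_mem;
  [exact: turing_le_bounded Fl|exact: recfun_nth].
- exact: recpred_imp.
Qed.

Lemma cond_le_admissible p q r (A : pred nat) : cond_le q p -> cond_le r q ->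
  (forall x, x \in res q -> A x) -> len q = len p ->
  admissible (len p) (stem p) A (len r) (initseg (stem r) (len r)).
Proof.
move=> [_ s1 _ _ _] [l2 s2 t2 _ _] HA E; rewrite E in l2 s2 t2.
apply/admissibleP; split=> // x xr; case: ltnP => xp; first by rewrite s2 ?s1.
by move=> /(t2 _ xp)/HA.
Qed.

Lemma extend p s Y A O : admissible (len p) (stem p) (fun x =>
  x \in res p) s (initseg Y s) ->
  unbounded A -> (forall x, x \in A -> x \in res p) -> turing_le (orc p) O ->
  turing_le A O -> avoids W O ->
  exists q, [/\ cond_le q p, stem q = trunc Y s, len q = s, res q = cut s A & orc q = O].
Proof.
move=> /admissibleP[ls HY] uA AR pO AO av.
have Yl x : x \in trunc Y s -> x < s by rewrite mem_trunc => /andP[].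
have Al x : x \in cut s A -> s <= x by rewrite mem_cut => /andP[].
exists (Cond Yl Al (unbounded_cut s uA) (turing_le_trans (base_orc p) pO)
   (turing_le_cut s AO) av); split=> //.
split=> //= x.
- move=> xl; have xs := leq_trans xl ls.
  by have := HY x xs; rewrite xl mem_trunc xs.
- rewrite mem_trunc => xl /andP[xs xY]; have := HY x xs.
  by rewrite ltnNge xl => /(_ xY).
- by rewrite mem_cut => /andP[_ /AR].
Qed.

Lemma admissible_self p A : admissible (len p) (stem p) A (len p) (initseg (stem p)
  (len p)).
Proof. by apply/admissibleP; split=> // x xl; rewrite xl. Qed.

Lemma trunc_self p : trunc (stem p) (len p) = stem p.
Proof.
apply/seteqP; split=> x /mem_set; rewrite ?mem_trunc; first by case/andP=> _ /set_mem.
by move=> xs; apply: set_mem; rewrite mem_trunc xs stem_len.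
Qed.

Lemma thin p A O : unbounded A -> (forall x, x \in A -> x \in res p) ->
  turing_le (orc p) O -> turing_le A O -> avoids W O ->
  exists q, [/\ cond_le q p, stem q = stem p, len q = len p,
    (forall x, (x \in res q) = (x \in A)) & orc q = O].
Proof.
move=> uA AR pO AO av.
have [q [qp Es El Er Eo]] := extend (admissible_self p _) uA AR pO AO av.
exists q; split=> //; first by rewrite Es trunc_self.
move=> x; rewrite Er mem_cut; case: (boolP (x \in A)) => [/AR/res_len ->|] //.
by rewrite andbF.
Qed.

Lemma extend1 p x : x \in res p -> exists q, [/\ cond_le q p, len p <= x < len q,
   x \in stem q, (forall y, y \in stem q -> y = x \/ y \in stem p) & orc q = orc p].
Proof.
move=> xp; pose Y := [set y | (y == x) || (y \in stem p)].
have YE y : (y \in Y) = (y == x) || (y \in stem p).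
  exact: (mem_set_pred (fun y => (y == x) || (y \in stem p))).
have lx := res_len xp.
have [|q [qp Es El Er Eo]] := @extend p x.+1 Y _ _ _ (@res_unb p) (fun _ => id)
  (turing_le_refl _) (@res_orc p) (@orc_av p).
  apply/admissibleP; split=> [|y yx]; first exact: leqW.
  rewrite YE; case: ltnP => yl.
    by case: eqP => // E; rewrite E ltnNge lx in yl.
  by case: eqP => [-> _ //|_ /= /stem_len]; rewrite ltnNge yl.
exists q; split=> //; first by rewrite lx El /=.
- by rewrite Es mem_trunc YE eqxx ltnSn.
- by move=> y; rewrite Es mem_trunc YE => /andP[_ /orP[/eqP|]]; [left|right].
Qed.
End Conditions.

(** * Shrinking into one side of a partition *)

Section Split.
Variables (W O A S : set nat).
Hypotheses (avO : avoids W O) (AO : turing_le A O) (uA : unbounded A).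
Let side (b : bool) (x : nat) : bool := (x \in S) == b.

(* The assumption to be refuted. It holds for each side, so each of the two
   forcings, with stems inside one side, must get stuck. *)
Hypothesis none : forall b A', unbounded A' -> (forall x, x \in A' -> x \in A) ->
  (forall x, x \in A' -> side b x) -> ~ avoids W (turing_join O A').

Let scond b := {p : cond W O |
  (forall x, x \in stem p -> side b x && (x \in A)) /\ (forall x, x \in res p ->
    x \in A)}.
Let sle b (q p : scond b) := cond_le (sval q) (sval p).
Let sstem b (p : scond b) := stem (sval p).
Let slen b (p : scond b) := len (sval p).

(** A reservoir meets both sides, as it would otherwise contradict [none]. *)
Lemma side_res b (p : scond b) b' : exists2 x, x \in res (sval p) & side b' x.
Proof.
apply: contrapT => H; have [_ rA] := svalP p.
apply: (@none (~~ b') (res (sval p))) => //; first exact: res_unb.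
  move=> x xr; apply/negPn/negP => nx; apply: H; exists x => //.
  by move: nx; rewrite /side; case: (_ \in _) b' => -[].
apply: avoids_le (@orc_av _ _ (sval p)); apply: le_join; [exact: base_orc|exact: res_orc].
Qed.

(** If no condition below [p0] blocked a functional, then the forcing would give
    an infinite cone-avoiding subset of the side [b]. *)
Lemma blocked b (p0 : scond b) : exists2 p, sle p p0 & exists c, forall q, sle q p ->
  ~ decides W O (@sle b) (@sstem b) (@slen b) c q.
Proof.
apply: contrapT => H.
have [||||||u [Y [[u0 uS] YE uY avY _]]] := @mathias_forcing W O _ (@sle b) (@sstem b)
    (@slen b) (fun _ _ => True) p0.
- by move=> p; exact: cond_le_refl.
- by move=> p q r; exact: cond_le_trans.
- by move=> p q; exact: cond_le_len.
- move=> p pp0; have [x xr xs] := side_res p b.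
  have [q [qp xl xq sq _]] := extend1 xr.
  have [sA rA] := svalP p.
  have okq : (forall x, x \in stem q -> side b x && (x \in A)) /\
             (forall x, x \in res q -> x \in A).
    split=> y; first by move=> /sq[->|/sA //]; rewrite xs rA.
    by case: qp => _ _ _ r _ /r/rA.
  by exists (exist _ q okq) => //; exists x.
- by move=> _ p _; exists p => //; exact: cond_le_refl.
- move=> c p pp0; apply: contrapT => K; apply: H; exists p => //; exists c => q qp Dq.
  by apply: K; exists q.
- have YS x : x \in Y -> side b x && (x \in A).
    have [xl ->] := YE x.+1; last exact: xl.
    by have [+ _] := svalP (u x.+1); apply.
  by apply: (@none b Y) => // x /YS/andP[].
Qed.

(** Inside the reservoir of a blocked condition [p1] for the first side, start
    the other forcing and take a blocked condition [p2] for it. For a subset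
    [X] of the reservoir of [p2] ask whether a finite subset of [X] on the
    first side, or of its complement on the second, gives a certain value.
    For a wrong value and [X := S] a yes would unblock one of the two
    conditions; for a correct value and a cone-avoiding [X], a no allows to
    shrink one of the two reservoirs to [X] or to its complement, which
    decides the functional of that side. *)
Lemma split_absurd : False.
Proof.
have unb0 : forall x, x \in A -> 0 <= x by [].
have st0 l : forall x, x \in (set0 : set nat) -> x < l by move=> x; rewrite in_set0.
pose p00 := Cond (st0 0) unb0 uA (turing_le_refl O) AO avO.
have ok0 b (p : cond W O) : stem p = set0 -> (forall x, x \in res p -> x \in A) ->
  (forall x, x \in stem p -> side b x && (x \in A)) /\ (forall x, x \in res p -> x \in A).
  by move=> -> H; split=> // x; rewrite in_set0.
have [p1 _ [c1 H1]] := blocked (exist _ p00 (ok0 true p00 erefl (fun _ => id))).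
have [s1A r1A] := svalP p1.
(* [p10] restarts with an empty stem, from the reservoir of [p1] *)
pose p10 := Cond (st0 (len (sval p1))) (@res_len _ _ (sval p1)) (@res_unb _ _ (sval p1))
   (@base_orc _ _ (sval p1)) (@res_orc _ _ (sval p1)) (@orc_av _ _ (sval p1)).
have [p2 p2p10 [c2 H2]] := blocked (exist _ p10 (ok0 false p10 erefl r1A)).
have [s2A r2A] := svalP p2.
have [l12 _ _ r12 o12] : cond_le (sval p2) p10 by [].
pose p b : cond W O := if b then sval p1 else sval p2.
pose c b := if b then c1 else c2.
have okP b : (forall x, x \in stem (p b) -> side b x && (x \in A)) by case: b.
have rP b x : x \in res (sval p2) -> x \in res (p b) by case: b => // /r12.
have rA b x : x \in res (p b) -> x \in A by case: b => [/r1A|/r2A].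
have oP b : turing_le (orc (p b)) (orc (sval p2)).
  by case: b => //; exact: turing_le_refl.
have HP b q : cond_le q (p b) -> (forall x, x \in stem q -> side b x) ->
    ~ exists n, converges O (c b) n (n \notin W) (len q) (initseg (stem q) (len q)) \/
      forall r, cond_le r q -> ~~ converges O (c b) n (n \in W) (len r) (initseg (stem
        r) (len r)).
  move=> qp sq Dq.
  have okq : (forall x, x \in stem q -> side b x && (x \in A)) /\
             (forall x, x \in res q -> x \in A).
    have [_ s t r _] := qp; split=> x; last by move=> /r/rA.
    move=> xq; rewrite sq //=; case: (ltnP x (len (p b))) => xl.
      by rewrite s // in xq; case/andP: (okP b x xq).
    by apply: (rA b); exact: t.
  case: b {okP rP rA oP sq} qp Dq okq => qp [n Dn] okq; [apply: (H1 (exist _ q okq))|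
    apply: (H2 (exist _ q okq))] => //; exists n; case: Dn => Dn;
    [left|right|left|right] => // r rq; exact: Dn.
pose Q b n i s t u := admissible (len (p b)) (stem (p b))
   (fun x => (x \in res (sval p2)) && (bit t x == b)) s u && converges O (c b) n i s u.
pose P n i s t := all (fun u => ~~ Q true n i s t u &&
  ~~ Q false n i s t u) (iota 0 (2 ^ s)).
have QP b n i s X Y : reflect (admissible (len (p b)) (stem (p b))
   (fun x => (x \in res (sval p2)) && ((x \in X) == b)) s (initseg Y s) /\
   converges O (c b) n i s (initseg Y s)) (Q b n i s (initseg X s) (initseg Y s)).
  apply: (iffP andP) => -[/admissibleP[ls H] cv]; split=> //; apply/admissibleP;
    split=> // x xs;
    by have := H x xs; rewrite bit_initseg xs.
have Pm n i : segment_monotone (P n i).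
  have Qm b s t X Y : s <= t -> Q b n i s (initseg X s) (initseg Y s) ->
      Q b n i t (initseg X t) (initseg (trunc Y s) t).
    move=> st /QP[/admissibleP[ls H] cv]; apply/QP; split.
      apply/admissibleP; split=> [|x xt]; first exact: leq_trans st.
      rewrite mem_trunc; case: (ltnP x s) => xs; first exact: H.
      by rewrite ltnNge (leq_trans ls xs).
    by apply: (converges_mono st); rewrite initseg_trunc.
  move=> s t X st /all_initsegP H; apply/all_initsegP => Y.
  by have /andP[nt nf] := H (trunc Y s); apply/andP; split;
    apply: contra (Qm _ _ _ _ _ st) _.
have Pd : recpred (orc (sval p2)) 4 (fun v => P (nth 0 v 0) (nth 0 v 1) (nth 0 v 2)
  (nth 0 v 3)).
  apply: (@recpred_all _ _ (fun v => 2 ^ nth 0 v 2) (fun u v =>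
    ~~ Q true (nth 0 v 0) (nth 0 v 1) (nth 0 v 2) (nth 0 v 3) u &&
    ~~ Q false (nth 0 v 0) (nth 0 v 1) (nth 0 v 2) (nth 0 v 3) u)).
    exact/recfun_exp2/recfun_nth.
  have nb k j : recfun (orc (sval p2)) k.+1 (fun w => nth 0 (behead w) j).
    exact: (recfun_behead (f := fun w => nth 0 w j) (recfun_nth _ _ _)).
  have Qd b : recpred (orc (sval p2)) 5 (fun w =>
    Q b (nth 0 (behead w) 0) (nth 0 (behead w) 1)
     (nth 0 (behead w) 2) (nth 0 (behead w) 3) (nth 0 w 0)).
    apply: recpred_and; last by apply: recpred_converges => //;
      [exact: base_orc|exact: recfun_nth].
    apply: (@recpred_admissible _ _ _ _ (fun x w => (x \in res (sval p2)) &&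
        (bit (nth 0 (behead w) 3) x == b)) (fun w => nth 0 (behead w) 2)
        (fun w => nth 0 w 0)) => //; [exact: stem_len| |exact: recfun_nth].
    apply: recpred_and; first by apply: recpred_mem; [exact: res_orc|exact: recfun_nth].
    apply: recpred_eqb; last exact: recfun_const.
    apply: recpred_bit; last exact: recfun_nth.
    exact: (recfun_behead (f := fun w => nth 0 (behead w) 3)).
  by apply: recpred_and; apply: recpred_not; exact: Qd.
case: (tree_dichotomy (@orc_av _ _ (sval p2)) Pd Pm) => [[n [s Hs]]|[n [X [HX avX]]]].
- have [b [Y /QP[aY cY]]] : exists b Y, Q b n (n \notin W) s (initseg S s) (initseg Y s).
    apply: contrapT => H; have /negP := Hs S; apply; apply/all_initsegP => Y.
    by apply/andP; split; apply/negP => QY; apply: H; do 2 eexists; exact: QY.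
  have [|q [qp Es El _ _]] := @extend _ _ (p b) s Y _ _ _ (@res_unb _ _ (sval p2)) (rP b)
     (oP b) (@res_orc _ _ (sval p2)) (@orc_av _ _ (sval p2)).
    move/admissibleP: aY => [ls H]; apply/admissibleP; split=> // x xs.
    by have := H x xs; case: ifP => // _ K /K /andP[/rP].
  apply: (HP b q) => //.
    move=> x; rewrite Es mem_trunc => /andP[xs xY].
    move/admissibleP: aY => [ls H]; have := H x xs; case: ifP => _;
      last by move=> /(_ xY)/andP[].
    by rewrite xY => /esym/okP/andP[].
  by exists n; left; rewrite Es El initseg_trunc.
- have [b uX] : exists b, unbounded [set x | (x \in res (sval p2)) && ((x \in X) == b)].
    apply: contrapT => /forallNP H.
    have H' b : exists m, forall x, m <= x -> x \in res (sval p2) -> (x \in X) != b.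
      have /existsNP[m Hm] := H b; exists m => x mx xr; apply/negP => xb.
      by apply: Hm; exists x => //; rewrite mem_set_pred xr.
    have [m1 Hm1] := H' true; have [m2 Hm2] := H' false.
    have [x] := @res_unb _ _ (sval p2) (maxn m1 m2).
    rewrite geq_max => /andP[x1 x2] xr; have := Hm1 x x1 xr; have := Hm2 x x2 xr.
    by case: (x \in X).
  have [||||q [qp Es El Er Eo]] := @thin _ _ (p b) _ (turing_join (orc (sval p2)) X) uX.
  + by move=> x; rewrite mem_set_pred => /andP[/rP].
  + exact: turing_le_trans (oP b) (le_join_l _ _).
  + apply: turing_le_recpred; apply: recpred_and.
      apply: recpred_mem; last exact: recfun_nth.
      exact: turing_le_trans (@res_orc _ _ _) (le_join_l _ _).
    apply: recpred_eqb; last exact: recfun_const.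
    by apply: recpred_mem; [exact: le_join_r|exact: recfun_nth].
  + exact: avX.
  apply: (HP b q) => //; first by move=> x; rewrite Es => /okP/andP[].
  exists n; right => r rq; apply/negP => cv.
  have /all_initsegP/(_ (stem r)) := HX (len r).
  suff : Q b n (n \in W) (len r) (initseg X (len r)) (initseg (stem r) (len r)).
    by case: b {uX qp Es El Er rq cv} => ->; rewrite ?andbF.
  apply/QP; split=> //; apply: (cond_le_admissible qp rq) => // x.
  by rewrite Er mem_set_pred.
Qed.
End Split.

(** The theorem of Dzhafarov and Jockusch. The partition is arbitrary: [S] need
    not be computable from anything that avoids the cone. *)
Lemma avoiding_split W O (A S : set nat) : avoids W O -> turing_le A O -> unbounded A ->
  exists (b : bool) (A' : set nat), [/\ unbounded A', forall x, x \in A' -> x \in A,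
    forall x, x \in A' -> (x \in S) = b & avoids W (turing_join O A')].
Proof.
move=> av AO uA; apply: contrapT => H; apply: (split_absurd (S := S) av AO uA).
move=> b A' uA' AA' Sb avA'; apply: H; exists b, A'; split=> // x /Sb/eqP //.
Qed.

Lemma avoiding_cover W O (A : set nat) N (S : nat -> set nat) :
  avoids W O -> turing_le A O -> unbounded A ->
  (forall x, x \in A -> exists2 j, j < N & x \in S j) ->
  exists j (A' : set nat), [/\ j < N, unbounded A', forall x, x \in A' -> x \in A,
    forall x, x \in A' -> x \in S j & avoids W (turing_join O A')].
Proof.
elim: N O A => [|N IH] O A av AO uA cov; first by have [x _ /cov[]] := uA 0.
have [b [A' [uA' AA' Sb avA']]] := avoiding_split (S N) av AO uA.
case: b Sb => Sb; first by exists N, A'; split.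
have [x xA'|j [A'' [jN uA'' AA'' SA'' avA'']]] := IH _ _ avA' (le_join_r O A') uA'.
  have [j] := cov x (AA' x xA'); rewrite ltnS leq_eqVlt => /orP[/eqP ->|jN xS].
    by rewrite Sb.
  by exists j.
exists j, A''; split=> //; first exact: ltnW.
- by move=> x /AA''/AA'.
- apply: avoids_le avA''; apply: le_join; last exact: le_join_r.
  exact: turing_le_trans (le_join_l _ _) (le_join_l _ _).
Qed.

(** Mathias forcing in which each set [S k] shrinks the reservoir by
    [avoiding_split]. There is no constraint on the stems, so a functional is
    decided by a plain search for a finite extension. *)
Lemma avoiding_cohesive W O (S : nat -> set nat) : avoids W O ->
  exists C : set nat, [/\ unbounded C, avoids W (turing_join O C) &
    forall k, exists l (b : bool), forall x, l <= x -> x \in C -> (x \in S k) = b].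
Proof.
move=> av.
have st0 : forall x, x \in (set0 : set nat) -> x < 0 by move=> x; rewrite in_set0.
have rl0 : forall x, x \in (setT : set nat) -> 0 <= x by [].
have uT : unbounded setT by move=> n; exists n => //; rewrite in_setT.
have TO : turing_le setT O.
  apply/turing_leP; apply: eq_recfun (recfun_const O 1 1) => v _; by rewrite in_setT.
pose p0 := Cond st0 rl0 uT (turing_le_refl O) TO av.
have [||||||u [C [[u0 uS] CE uC avC HC]]] := @mathias_forcing W O _ (@cond_le W O)
    (@stem W O) (@len W O)
    (fun k q => exists b : bool, forall x, x \in res q -> (x \in S k) = b) p0.
- exact: cond_le_refl.
- exact: cond_le_trans.
- exact: cond_le_len.
- move=> p _; have [x _ xr] := @res_unb _ _ p 0.
  have [q [qp xl xq _ _]] := extend1 xr; by exists q => //; exists x.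
- move=> k p _.
  have [b [A' [uA' AA' Sb avA']]] := avoiding_split (S k) (@orc_av _ _ p) (@res_orc _ _ p)
    (@res_unb _ _ p).
  have [q [qp _ _ Er _]] := thin uA' AA' (le_join_l (orc p) A') (le_join_r _ _) avA'.
  by exists q => //; exists b => x; rewrite Er; exact: Sb.
- move=> c p _.
  pose D n i s := has (fun t => admissible (len p) (stem p) (fun x => x \in res p) s t &&
     converges O c n i s t) (iota 0 (2 ^ s)).
  have [|n [[s /hasP[t]]|Dn]] := enum_or_miss (D := D) (@orc_av _ _ p).
  + have nb k j : recfun (orc p) k.+1 (fun w => nth 0 (behead w) j).
      exact: (recfun_behead (f := fun w => nth 0 w j) (recfun_nth _ _ _)).
    apply: (@recpred_has _ _ (fun v => 2 ^ nth 0 v 2) (fun t v =>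
      admissible (len p) (stem p) (fun x => x \in res p) (nth 0 v 2) t &&
      converges O c (nth 0 v 0) (nth 0 v 1) (nth 0 v 2) t));
        first exact/recfun_exp2/recfun_nth.
    apply: recpred_and; last by apply: recpred_converges => //;
      [exact: base_orc|exact: recfun_nth].
    apply: (@recpred_admissible _ _ _ _ (fun x w => x \in res p) (fun w =>
      nth 0 (behead w) 2)
        (fun w => nth 0 w 0)) => //; [exact: stem_len| |exact: recfun_nth].
    by apply: recpred_mem; [exact: res_orc|exact: recfun_nth].
  + rewrite mem_iota /= => /initseg_bits <- /andP[at' ct].
    have [q [qp Es El _ _]] := extend at' (@res_unb _ _ p) (fun _ => id)
      (turing_le_refl _) (@res_orc _ _ p) (@orc_av _ _ p).
    by exists q => //; exists n; left; rewrite Es El initseg_trunc.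
  + exists p; first exact: cond_le_refl.
    exists n; right => r rp; apply/negP => cv; have /hasPn/(_ (initseg (stem r) (len
      r))) := Dn (len r).
    rewrite mem_iota /= bitcode_lt cv andbT => /(_ isT)/negP; apply.
    exact: (cond_le_admissible (cond_le_refl p) rp).
- exists C; split=> // k; have [b Hb] := HC k.
  exists (len (u k.+1)), b => x lx xC; apply: Hb.
  have [xl E] := CE x.+1; rewrite E // in xC.
  case: (leqP k x) => kx; last first.
    by have [l _ _ _ _] := uS _ _ (ltnW kx : x.+1 <= k.+1);
      rewrite ltnNge (leq_trans _ lx) // in xl;
       exact: leq_trans l.
  by have [_ _ t _ _] := uS k.+1 x.+1 kx; apply: t.
Qed.

(** * Pairing, and conflict graphs of bounded degree *)

Lemma nth_iter_behead (v : seq nat) j i : nth 0 (iter j behead v) i = nth 0 v (j + i).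
Proof. by elim: j i => // j IH i; rewrite iterS nth_behead IH addnS. Qed.

Lemma size_iter_behead (v : seq nat) j : size (iter j behead v) = size v - j.
Proof. by elim: j => [|j IH]; rewrite ?subn0 // iterS size_behead IH subnS. Qed.

Lemma recfun_plug O k j f e : recfun O k.+1 (fun w => f (nth 0 w 0) (behead w)) ->
  recfun O (j + k) e -> recfun O (j + k) (fun w => f (e w) (iter j behead w)).
Proof.
move=> Hf He; pose F u := f (nth 0 u 0) (behead u).
pose gs : seq (seq nat -> nat) := e :: mkseq (fun i w => nth 0 w (j + i)) k.
apply: (@eq_recfun _ _ (fun w => F [seq g w | g <- gs])) => [v sv|].
  rewrite /F /= -map_comp; congr f.
  apply: (@eq_from_nth _ 0); rewrite size_map size_iota.
    by rewrite size_iter_behead sv addKn.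
  by move=> i hi; rewrite (nth_map 0) ?size_iota //= nth_iota // nth_iter_behead.
apply: (@recfun_subst _ _ F gs); first by rewrite /= size_map size_iota.
rewrite /= size_map size_iota => -[|i] hi //=.
by rewrite (nth_map 0) ?size_iota // nth_iota //; exact: recfun_nth.
Qed.

Lemma recfun_iter_behead O k j f : recfun O k f -> recfun O (j + k) (fun w =>
  f (iter j behead w)).
Proof.
move=> Hf; elim: j => // j IH; apply: eq_recfun (recfun_behead IH) => v _.
by rewrite iterSr.
Qed.

(** A quadratic pairing: the square of [a + b] determines [a + b], as the
    remainder [a] does not reach the next square. *)
Definition npair (a b : nat) : nat := (a + b) * (a + b) + a.

Lemma npair_inj a b c d : npair a b = npair c d -> a = c /\ b = d.
Proof.
have lt x y x' y' : x + y < x' + y' -> npair x y < npair x' y'.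
  move=> h; rewrite /npair; apply: leq_trans (leq_addr _ _).
  apply: (@leq_trans ((x + y).+1 * (x + y).+1)); last by rewrite leq_mul.
  by rewrite mulSn mulnS addnA [ltnRHS]addnC ltn_add2l addSn ltnS -addnA leq_addr.
move=> E; have S : a + b = c + d.
  by case: (ltngtP (a + b) (c + d)) => // /lt; rewrite E ltnn.
by move: E; rewrite /npair S => /addnI E; rewrite -E in S *; move/addnI: S.
Qed.

Lemma npair_geq_l a b : a <= npair a b. Proof. exact: leq_addl. Qed.

Lemma npair_geq_r a b : b <= npair a b.
Proof.
rewrite /npair; apply: leq_trans (leq_addr _ _).
apply: leq_trans (leq_addl a b) _; case: (a + b) => // n; exact: leq_pmulr.
Qed.

Lemma npair_mono a b c d : a <= c -> b <= d -> npair a b <= npair c d.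
Proof. by move=> ac bd; rewrite leq_add // leq_mul // leq_add. Qed.

Lemma recfun_npair O k a b : recfun O k a -> recfun O k b -> recfun O k (fun v =>
  npair (a v) (b v)).
Proof. by move=> Ha Hb; apply: recfun_add => //; apply: recfun_mul;
  exact: recfun_add. Qed.

Definition chi (X : set nat) : pred nat := fun x => x \in X.

(** A graph on numbers is an arbitrary set of codes of ordered pairs; adjacency
    is symmetrized, so that no symmetry has to be required of the set. *)
Definition adj (g : pred nat) (p q : nat) : bool := g (npair p q) || g (npair q p).

Lemma adj_sym g p q : adj g p q = adj g q p. Proof. exact: orbC. Qed.

Definition degree_le (K : nat) (g : pred nat) : Prop :=
  forall p (s : seq nat), uniq s -> all (adj g p) s -> size s <= K.

Lemma adjU X Y p q : adj (chi (X `|` Y)) p q = adj (chi X) p q || adj (chi Y) p q.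
Proof. by rewrite /adj /chi !in_setU orbACA. Qed.

Lemma degree_leU K L X Y : degree_le K (chi X) -> degree_le L (chi Y) ->
  degree_le (K + L) (chi (X `|` Y)).
Proof.
move=> dX dY p s us /allP as_; rewrite -(count_predC (adj (chi X) p) s) -!size_filter.
apply: leq_add.
  by apply: (dX p); [exact: filter_uniq|exact: filter_all].
apply: (dY p); first exact: filter_uniq.
apply/allP => q; rewrite mem_filter => /andP[/= nX qs].
by have := as_ q qs; rewrite adjU (negPf nX).
Qed.

(** Each of finitely many vertices has finitely many neighbors. *)
Lemma degree_far K g : degree_le K g -> forall M, exists m, forall p q, p < M ->
  m <= q -> ~~ adj g p q.
Proof.
move=> dg; elim=> [|M [m Hm]]; first by exists 0.
have [m' Hm'] : exists m', forall q, m' <= q -> ~~ adj g M q.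
  apply: contrapT => /forallNP H.
  suff [s us [as_ ss]] : exists2 s, uniq s & all (adj g M) s /\ size s = K.+1.
    by have := dg M s us as_; rewrite ss ltnn.
  elim: K.+1 => [|k [s us [as_ ss]]]; first by exists [::].
  have /existsNP[q /not_implyP[hq /negP/negPn aq]] := H (\max_(x <- s) x).+1.
  exists (q :: s); last by rewrite /= aq as_ ss.
  rewrite /= us andbT; apply/negP => qs.
  by have := @leq_bigmax_seq _ s xpredT id q qs isT; rewrite leqNgt hq.
exists (maxn m m') => p q; rewrite geq_max ltnS leq_eqVlt => /orP[/eqP ->|pM] /andP[h h'].
  exact: Hm'.
exact: Hm.
Qed.

Lemma degree_pigeonhole K g (v w : nat -> nat) : degree_le K g -> injective w ->
  forall l (xs : seq nat), uniq xs -> K * l < size xs ->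
  exists2 x, x \in xs & forall a, a < l -> ~~ adj g (v a) (w x).
Proof.
move=> dg iw; elim=> [|l IH] xs uxs.
  by rewrite muln0; case: xs uxs => // x xs _ _; exists x => //; rewrite mem_head.
rewrite mulnS => sz; pose f x := adj g (v l) (w x).
have [||x] := IH (filter (predC f) xs); first exact: filter_uniq.
  have : size (filter f xs) <= K.
    rewrite -(size_map w); apply: (dg (v l)); first by rewrite map_inj_uniq ?filter_uniq.
    by apply/allP => q /mapP[x]; rewrite mem_filter => /andP[fx _] ->.
  move: sz; rewrite -[in size xs](count_predC f) !size_filter => sz cf.
  by rewrite -(ltn_add2l K) (leq_trans sz) // leq_add2r.
rewrite mem_filter => /andP[/= nfx xxs] H; exists x => // a.
by rewrite ltnS leq_eqVlt => /orP[/eqP -> //|]; exact: H.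
Qed.

(** A vertex [npair a b] stands for the pair of [a] and [b] when [a < b], and
    for the point [a] when [a = b]. Conflicts matter between two distinct
    pairs, or two distinct points; a graph can thus describe conflicts in both
    dimensions. *)
Definition shape (a b c d : nat) : bool :=
  [&& a <= b, c <= d, (a == b) == (c == d) & ~~ ((a == c) && (b == d))].

(** The quadruples to be tested are restricted by [Q]: independence of a set and
    the compatibility of a graph with a condition are both of this form. *)
Definition quadfree (Q : nat -> nat -> nat -> nat -> bool) (g : pred nat) : Prop :=
  forall a b c d, Q a b c d -> shape a b c d -> ~~ adj g (npair a b) (npair c d).

Definition quadb (Q : nat -> nat -> nat -> nat -> bool) (g : pred nat) (s : nat) : bool :=
  all (fun a => all (fun b => all (fun c => all (fun d =>
    Q a b c d && shape a b c d ==> ~~ adj g (npair a b) (npair c d))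
    (iota 0 s)) (iota 0 s)) (iota 0 s)) (iota 0 s).

Lemma quadbP (Q : nat -> nat -> nat -> nat -> bool) g s : reflect (forall a b c d,
  a < s -> b < s -> c < s -> d < s ->
   Q a b c d -> shape a b c d -> ~~ adj g (npair a b) (npair c d)) (quadb Q g s).
Proof.
have io x : x \in iota 0 s = (x < s) by rewrite mem_iota.
apply: (iffP allP) => [H a b c d|H a].
  rewrite -!io => ha hb hc hd q sh.
  by have /allP/(_ b hb)/allP/(_ c hc)/allP/(_ d hd)/implyP := H a ha; rewrite q; apply.
rewrite io => ha; apply/allP => b; rewrite io => hb; apply/allP => c; rewrite io => hc.
by apply/allP => d; rewrite io => hd; apply/implyP => /andP[]; exact: H.
Qed.

Lemma recpred_quadb O k (Q : nat -> nat -> nat -> nat -> seq nat -> bool)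
    (g : nat -> seq nat -> bool) s :
  recpred O (4 + k) (fun w => Q (nth 0 w 3) (nth 0 w 2) (nth 0 w 1) (nth 0 w 0)
    (iter 4 behead w)) ->
  recpred O k.+1 (fun w => g (nth 0 w 0) (behead w)) -> recfun O k s ->
  recpred O k (fun v => quadb (fun a b c d => Q a b c d v) (g^~ v) (s v)).
Proof.
move=> HQ Hg Hs.
have Hs' j : recfun O (j + k) (fun w => s (iter j behead w)) by exact: recfun_iter_behead.
apply: (@recpred_all _ _ s (fun a v => all (fun b => all (fun c => all (fun d =>
    Q a b c d v && shape a b c d ==> ~~ adj (g^~ v) (npair a b) (npair c d))
    (iota 0 (s v))) (iota 0 (s v))) (iota 0 (s v)))) => //.
apply: (@recpred_all _ _ (fun w => s (behead w)) (fun b w => all (fun c => all (fun d =>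
    Q (nth 0 w 0) b c d (behead w) && shape (nth 0 w 0) b c d ==>
    ~~ adj (g^~ (behead w)) (npair (nth 0 w 0) b) (npair c d))
    (iota 0 (s (behead w)))) (iota 0 (s (behead w))))); first exact: (Hs' 1).
apply: (@recpred_all _ _ (fun w => s (iter 2 behead w)) (fun c w => all (fun d =>
    Q (nth 0 (behead w) 0) (nth 0 w 0) c d (iter 2 behead w) &&
    shape (nth 0 (behead w) 0) (nth 0 w 0) c d ==>
    ~~ adj (g^~ (iter 2 behead w)) (npair (nth 0 (behead w) 0) (nth 0 w 0)) (npair c d))
    (iota 0 (s (iter 2 behead w))))); first exact: (Hs' 2).
apply: (@recpred_all _ _ (fun w => s (iter 3 behead w)) (fun d w =>
    Q (nth 0 (iter 2 behead w) 0) (nth 0 (behead w) 0) (nth 0 w 0) d (iter 3 behead w) &&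
    shape (nth 0 (iter 2 behead w) 0) (nth 0 (behead w) 0) (nth 0 w 0) d ==>
    ~~ adj (g^~ (iter 3 behead w)) (npair (nth 0 (iter 2 behead w) 0) (nth 0 (behead w)
      0))
        (npair (nth 0 w 0) d))); first exact: (Hs' 3).
apply: (@eq_recfun _ _ (fun w =>
    Q (nth 0 w 3) (nth 0 w 2) (nth 0 w 1) (nth 0 w 0) (iter 4 behead w) &&
    shape (nth 0 w 3) (nth 0 w 2) (nth 0 w 1) (nth 0 w 0) ==>
    ~~ adj (g^~ (iter 4 behead w)) (npair (nth 0 w 3) (nth 0 w 2))
        (npair (nth 0 w 1) (nth 0 w 0)))).
  by move=> w _; rewrite !nth_behead.
have Hga e : recfun O (4 + k) e -> recpred O (4 + k) (fun w => g (e w) (iter 4 behead w)).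
  exact: (recfun_plug (f := fun z v => g z v)).
have n i : recfun O (4 + k) (fun w => nth 0 w i) by exact: recfun_nth.
apply: recpred_imp; first apply: recpred_and => //.
  apply: recpred_and; first exact: recpred_leq.
  apply: recpred_and; first exact: recpred_leq.
  by apply: recpred_and; [apply: recpred_eqb; exact:
    recpred_eq|apply/recpred_not/recpred_and; exact: recpred_eq].
by apply: recpred_not; apply: recpred_or; apply: Hga; do !apply: recfun_npair.
Qed.

Definition all_in (Y : pred nat) (a b c d : nat) : bool := [&& Y a, Y b, Y c & Y d].
Definition indep (g : pred nat) (Y : pred nat) : Prop := quadfree (all_in Y) g.

Lemma indepU X Y P : indep (chi X) P -> indep (chi Y) P -> indep (chi (X `|` Y)) P.
Proof. by move=> iX iY a b c d q sh; rewrite adjU negb_or iX ?iY. Qed.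

Lemma indepUP X Y P : indep (chi (X `|` Y)) P -> indep (chi X) P /\ indep (chi Y) P.
Proof.
by move=> H; split=> a b c d q sh; have := H a b c d q sh; rewrite adjU negb_or =>
  /andP[].
Qed.

Lemma sub_indep g (P P' : pred nat) : subpred P' P -> indep g P -> indep g P'.
Proof.
move=> sP iP a b c d /and4P[a' b' c' d']; apply: iP; apply/and4P; split; exact: sP.
Qed.

Definition adjoin (F : set nat) (y : nat) : pred nat := fun x => (x == y) || (x \in F).

(** A far point [y] is joined to [F] by the pairs [npair a y]. They are far
    vertices, so by [degree_far] they have no conflict with the pairs inside
    [F]; only conflicts between two of them remain, and these are excluded by
    assumption. *)
Lemma indep_adjoin K g l F : degree_le K g -> (forall x, x \in F -> x < l) ->
  indep g (chi F) ->
  exists m, forall y, m <= y ->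
    (forall a c, a \in F -> c \in F -> a != c -> ~~ adj g (npair a y) (npair c y)) ->
    indep g (adjoin F y).
Proof.
move=> dg Fl iF; have [m Hm] := degree_far dg (npair l l).+1.
exists (maxn l m) => y; rewrite geq_max => /andP[ly my] Hy.
have far a b c : a \in F -> b \in F -> ~~ adj g (npair a b) (npair c y).
  move=> /Fl al /Fl bl; apply: Hm; first by rewrite ltnS npair_mono // ltnW.
  by apply: leq_trans my _; exact: npair_geq_r.
have ltF x z : x <= z -> z \in F -> x = y \/ x \in F -> x \in F.
  by move=> xz /Fl zl [xy|//]; rewrite xy leqNgt (leq_trans zl ly) in xz.
move=> a b c d /and4P[]; rewrite /adjoin.
move=> ha hb hc hd /and4P[ab cd /eqP eq ne].
have ha' : a = y \/ a \in F by case/orP: ha => [/eqP|]; [left|right].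
have hc' : c = y \/ c \in F by case/orP: hc => [/eqP|]; [left|right].
case/orP: hb => [/eqP by_|bF]; case/orP: hd => [/eqP dy|dF].
- rewrite by_ dy in ne eq *; case: ha' hc' eq ne => [->|aF] [->|cF]; rewrite ?eqxx //=.
  + by move=> /esym/eqP ->; rewrite eqxx.
  + by move=> /eqP ->; rewrite eqxx.
  + by rewrite andbT => _; exact: Hy.
- rewrite by_ adj_sym; apply: far => //; exact: (ltF _ _ cd dF hc').
- rewrite dy; apply: far => //; exact: (ltF _ _ ab bF ha').
- apply: iF; first by apply/and4P; split; rewrite /chi //;
  [exact: (ltF _ _ ab bF ha')|exact: (ltF _ _ cd dF hc')].
  by apply/and4P; split=> //; apply/eqP.
Qed.

(** * Finite approximations of graphs *)

Lemma adj_initseg X s p q : adj (bit (initseg X s)) p q -> adj (chi X) p q.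
Proof. by rewrite /adj /chi !bit_initseg => /orP[] /andP[_ ->]; rewrite ?orbT. Qed.

Lemma adj_initseg_mono X s t p q : s <= t -> adj (bit (initseg X s)) p q ->
  adj (bit (initseg X t)) p q.
Proof.
by move=> st; rewrite /adj !bit_initseg => /orP[] /andP[ps ->];
  rewrite (leq_trans ps st) ?orbT.
Qed.

Lemma adj_initseg_exact X s p q : npair p q < s -> npair q p < s ->
  adj (bit (initseg X s)) p q = adj (chi X) p q.
Proof. by move=> pq qp; rewrite /adj /chi !bit_initseg pq qp. Qed.

Definition degree_leb (K : nat) (g : pred nat) (s : nat) : bool :=
  all (fun p => count (adj g p) (iota 0 s) <= K) (iota 0 s).

Lemma degree_le_leb K X s : degree_le K (chi X) -> degree_leb K (bit (initseg X s)) s.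
Proof.
move=> dX; apply/allP => p _; rewrite -size_filter; apply: (dX p).
  by rewrite filter_uniq ?iota_uniq.
by apply/allP => q; rewrite mem_filter => /andP[/adj_initseg].
Qed.

Lemma degree_leb_mono K X s t : s <= t -> degree_leb K (bit (initseg X t)) t ->
  degree_leb K (bit (initseg X s)) s.
Proof.
move=> st /allP H; apply/allP => p; rewrite mem_iota => /= ps.
have := H p; rewrite mem_iota => /(_ (leq_trans ps st)); apply: leq_trans.
rewrite -(subnKC st) iotaD count_cat; apply: leq_trans (leq_addr _ _).
by apply: sub_count => q; apply: adj_initseg_mono; exact: leq_addr.
Qed.

(** The neighbors of [p] in a finite list, with the codes of the edges, all lie
    below a sufficiently large [s]. *)
Lemma degree_leb_limit K X : (forall s, degree_leb K (bit (initseg X s)) s) ->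
  degree_le K (chi X).
Proof.
move=> H p s us /allP as_; pose M := maxn p (\max_(x <- s) x); pose t := (npair M M).+1.
have qM q : q \in s -> q <= M.
  by move=> qs; apply: leq_trans (leq_maxr _ _);
    exact: (@leq_bigmax_seq _ s xpredT id q qs isT).
have pM : p <= M by exact: leq_maxl.
have Mt x : x <= M -> x < t by move=> xM; rewrite ltnS (leq_trans xM) ?npair_geq_l.
have /allP/(_ p) := H t; rewrite mem_iota => /(_ (Mt _ pM)); apply: leq_trans.
rewrite -size_filter; apply: uniq_leq_size => // q qs.
have qm := qM q qs; rewrite mem_filter mem_iota /= (Mt q qm) andbT.
by rewrite adj_initseg_exact; [exact: as_|rewrite ltnS npair_mono|rewrite ltnS
  npair_mono].
Qed.

Lemma quadb_mono Q X s t : s <= t -> quadb Q (bit (initseg X t)) t ->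
  quadb Q (bit (initseg X s)) s.
Proof.
move=> st /quadbP H; apply/quadbP => a b c d ha hb hc hd q sh.
by apply: contra (H a b c d _ _ _ _ q sh); [exact: adj_initseg_mono|..];
  exact: leq_trans st.
Qed.

Lemma quadfree_quadb Q X s : quadfree Q (chi X) -> quadb Q (bit (initseg X s)) s.
Proof.
move=> H; apply/quadbP => a b c d _ _ _ _ q sh; apply: contra (H a b c d q sh).
exact: adj_initseg.
Qed.

(** Below this length, an initial segment of a graph decides adjacency of all
    vertices with entries below [r] exactly. A truncated graph has fewer
    edges, so on longer ranges independence for it may be misleading. *)
Definition vertex_bound (r : nat) : nat := (npair (npair r r) (npair r r)).+1.

Lemma lt_vertex_bound a b c d r : a < r -> b < r -> c < r -> d < r ->
  npair (npair a b) (npair c d) < vertex_bound r.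
Proof. by move=> *; rewrite ltnS !npair_mono // ltnW. Qed.

Lemma quadb_exact Q X r s : vertex_bound r <= s ->
  quadb Q (bit (initseg X s)) r = quadb Q (chi X) r.
Proof.
move=> rs; apply/quadbP/quadbP => H a b c d ha hb hc hd q sh;
  have := H a b c d ha hb hc hd q sh; rewrite adj_initseg_exact //;
  by apply: leq_trans rs; rewrite lt_vertex_bound.
Qed.

Lemma quadb_limit Q X : (forall s, quadb Q (bit (initseg X s)) s) -> quadfree Q (chi X).
Proof.
move=> H a b c d q sh; pose r := (a + b + c + d).+1.
have ha : a < r by rewrite ltnS -!addnA leq_addr.
have hb : b < r by rewrite ltnS -!addnA addnCA leq_addr.
have hc : c < r by rewrite ltnS -addnA addnCA leq_addr.
have hd : d < r by rewrite ltnS leq_addl.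
have rainbow_on x : x < r -> x < vertex_bound r.
  by move=> xr; apply: ltnW; rewrite ltnS; apply: leq_trans (npair_geq_l _ _);
    exact: leq_trans xr (npair_geq_l _ _).
have /quadbP/(_ a b c d) := H (vertex_bound r).
rewrite adj_initseg_exact ?lt_vertex_bound //; apply=> //; exact: rainbow_on.
Qed.

Lemma indepbP g Y s : reflect (indep g (chi (trunc Y s))) (quadb (all_in (bit (initseg
  Y s))) g s).
Proof.
have E x : bit (initseg Y s) x = chi (trunc Y s) x by rewrite bit_initseg /chi mem_trunc.
have lt x : chi (trunc Y s) x -> x < s by rewrite /chi mem_trunc => /andP[].
apply: (iffP (quadbP _ _ _)) => H a b c d.
  move=> /and4P[ha hb hc hd] sh; apply: H => //; try exact: lt.
  by rewrite /all_in !E; apply/and4P.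
by move=> _ _ _ _; rewrite /all_in !E; exact: H.
Qed.

Definition point_graph (m : set nat) : Prop :=
  forall z, z \in m -> exists a c, z = npair (npair a a) (npair c c).

(** The conflicts that [y] causes, read as a graph on points. In this form the
    finite sets that suit [y] are the independent ones, and they can be asked
    for before any [y] is chosen. *)
Definition type_graph (g : pred nat) (y : nat) : set nat :=
  [set z | exists a c, [/\ z = npair (npair a a) (npair c c), a != c &
    adj g (npair a y) (npair c y)]].

Lemma type_graph_adjP g y p q : reflect
  (exists a c, [/\ p = npair a a, q = npair c c, a != c & adj g (npair a y) (npair c y)])
  (adj (chi (type_graph g y)) p q).
Proof.
apply: (iffP orP); rewrite /chi !in_setE.
  move=> [] [a [c [/npair_inj[-> ->] ne ad]]]; first by exists a, c.
  by exists c, a; rewrite eq_sym adj_sym.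
by move=> [a [c [-> -> ne ad]]]; left; exists a, c.
Qed.

Lemma type_graph_point g y : point_graph (type_graph g y).
Proof. by move=> z; rewrite in_setE => -[a [c [-> _ _]]]; exists a, c. Qed.

(** The map from [npair c c] to [npair c y] sends the neighbors of a point [a]
    injectively to neighbors of [npair a y]. *)
Lemma degree_type_graph K g y : degree_le K g -> degree_le K (chi (type_graph g y)).
Proof.
move=> dg p s us /allP as_.
(* a function that decodes the points [npair c c] *)
have [|dc Hdc] := @choice _ _ (fun q c => (exists c', q = npair c' c') -> q = npair c c).
  move=> q; have [[c ->]|nq] := pselect (exists c', q = npair c' c'); first by exists c.
  by exists 0 => /nq.
have dcE c : dc (npair c c) = c.
  by have /npair_inj[] := Hdc (npair c c) (ex_intro _ c erefl).
have H q : q \in s -> q = npair (dc q) (dc q) /\ adj g (npair (dc p) y) (npair (dc q) y).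
  by move=> /as_/type_graph_adjP[a [c [-> -> ne ad]]]; rewrite !dcE.
rewrite -(size_map (fun q => npair (dc q) y)); apply: (dg (npair (dc p) y)).
  rewrite map_inj_in_uniq // => q q' /H[Eq _] /H[Eq' _] /npair_inj[E _].
  by rewrite Eq Eq' E.
by apply/allP => _ /mapP[q /H[_ ad] ->].
Qed.

Lemma indep_type_graph g F y : (forall x, x \in F -> x < y) -> indep g (adjoin F y) ->
  indep (chi (type_graph g y)) (chi F).
Proof.
move=> Fy iF a b c d /and4P[ha hb hc hd] sh; apply/negP => /type_graph_adjP.
move=> [a' [c' [/npair_inj[Ea _] /npair_inj[Ec _] ne]]]; rewrite -Ea -Ec in ne *.
rewrite /chi in ha hc; apply/negP/iF; first by rewrite /all_in /adjoin eqxx /= ha hc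
  !orbT.
have /ltn_eqF ay := Fy a ha; have /ltn_eqF cy := Fy c hc.
by rewrite /shape ay cy eqxx (negPf ne) (ltnW (Fy a ha)) (ltnW (Fy c hc)).
Qed.

(** * Types over a finite set *)

Lemma mem_iota0 n x : (x \in iota 0 n) = (x < n).
Proof. by rewrite mem_iota. Qed.

Lemma point_graph_adj m p q : point_graph m -> adj (chi m) p q ->
  exists a c, p = npair a a /\ q = npair c c.
Proof.
by move=> pm /orP[] /pm[a [c /npair_inj[-> ->]]]; [exists a, c|exists c, a].
Qed.

Lemma unbounded_seq A : unbounded A ->
  forall n, exists s, [/\ uniq s, size s = n & forall x, x \in s -> x \in A].
Proof.
move=> uA; elim=> [|n [s [us ss sA]]]; first by exists [::].
have [x xs xA] := uA (\max_(y <- s) y).+1.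
exists (x :: s); split=> /=; last 1 first.
- by move=> y; rewrite in_cons => /orP[/eqP ->|/sA].
- rewrite us andbT; apply/negP => xs'.
  by have := @leq_bigmax_seq _ s xpredT id x xs' isT; rewrite leqNgt xs.
- by rewrite ss.
Qed.

Lemma indep_add_point m F x : point_graph m -> indep (chi m) (chi F) ->
  (forall a, a \in F -> ~~ adj (chi m) (npair a a) (npair x x)) ->
    indep (chi m) (adjoin F x).
Proof.
move=> pm iF Hx a b c d /and4P[ha hb hc hd] sh; apply/negP => ad.
have [a' [c' [/npair_inj[Ea Eb] /npair_inj[Ec Ed]]]] := point_graph_adj pm ad.
rewrite -{}Ea in Eb; rewrite -{}Ec in Ed; rewrite {}Eb {}Ed in ad sh hb hd *.
have ne : a != c by move: sh; rewrite /shape andbb => /and4P[].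
move: ha hc; rewrite /adjoin => /orP[/eqP Ea|aF] /orP[/eqP Ec|cF].
- by rewrite Ea Ec eqxx in ne.
- by rewrite Ea adj_sym (negPf (Hx c cF)) in ad.
- by rewrite Ec (negPf (Hx a aF)) in ad.
- by rewrite (negPf (iF a a c c _ sh)) // /all_in /chi aF cF in ad.
Qed.

Section ExtendTypes.
Variables (W O h : set nat) (K0 : nat).
Hypothesis dh : degree_le K0 (chi h).

(** A Mathias condition with its promise. The last field lets any element of
    the reservoir be the next one of the stem; it does not make larger subsets
    of the reservoir independent. *)
Record rcond := RCond {
  rc :> cond W O; prom : set nat; pdeg : nat;
  prom_orc : turing_le prom (orc rc);
  prom_deg : degree_le pdeg (chi prom);
  prom_ok : forall y, y \in res rc -> indep (chi (prom `|` h)) (adjoin (stem rc) y) }.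

Definition rcond_le (q p : rcond) : Prop := cond_le q p /\ forall z, z \in prom p ->
  z \in prom q.

Lemma rcond_le_refl p : rcond_le p p.
Proof. by split=> //; exact: cond_le_refl. Qed.

Lemma rcond_le_trans p q r : rcond_le q p -> rcond_le r q -> rcond_le r p.
Proof. by move=> [c1 s1] [c2 s2]; split=> [|z /s1/s2 //]; exact: cond_le_trans c2. Qed.

Lemma stem_ok (p : rcond) : indep (chi (prom p `|` h)) (chi (stem p)).
Proof.
have [y _ yr] := @res_unb _ _ p 0.
by apply: sub_indep (prom_ok yr) => x; rewrite /adjoin /chi => ->; rewrite orbT.
Qed.

(** If for every possible type there is a good continuation of the stem below
    [s], then each [y] of the reservoir has one of the finitely many
    continuations that suits its own type. By [avoiding_cover] one of them
    suits a cone-avoiding infinite set of points; after removal of the points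
    that are not far, this set can be the reservoir of the new stem. *)
Lemma extend_types (p : rcond) s (Phi : nat -> Prop) :
  (forall m, point_graph m -> degree_le (pdeg p + K0) (chi m) ->
    indep (chi m) (chi (stem p)) ->
    exists Y, [/\ admissible (len p) (stem p) (chi (res p)) s (initseg Y s),
      indep (chi (prom p `|` h)) (chi (trunc Y s)), indep (chi m) (chi (trunc Y s))
    & Phi (initseg Y s)]) ->
  exists q, [/\ rcond_le q p, len q = s & Phi (initseg (stem q) s)].
Proof.
move=> H; pose G := chi (prom p `|` h).
have dG : degree_le (pdeg p + K0) G by apply: degree_leU; [exact: prom_deg|].
pose S t : set nat := [set y | exists Y, [/\ t = initseg Y s,
  admissible (len p) (stem p) (chi (res p)) s (initseg Y s), indep G (chi (trunc Y s)),
  indep (chi (type_graph G y)) (chi (trunc Y s)) & Phi (initseg Y s)]].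
have [y yr|t [A [_ uA AR AS avA]]] := @avoiding_cover W (orc p) (res p) (2 ^ s) S
    (@orc_av _ _ p) (@res_orc _ _ p) (@res_unb _ _ p).
  have [|||Y [aY iY mY PY]] := H (type_graph G y).
  - exact: type_graph_point.
  - exact: degree_type_graph.
  - apply: indep_type_graph (prom_ok yr) => x /stem_len xl.
    exact: leq_trans xl (res_len yr).
  by exists (initseg Y s); [exact: bitcode_lt | rewrite in_setE; exists Y].
have [y0 _ /AS] := uA 0; rewrite in_setE => -[Y [tY aY iY _ PY]].
have [|m Hm] := @indep_adjoin _ _ s _ dG _ iY.
  by move=> x; rewrite mem_trunc => /andP[].
have [|q [qp Es El Er Eo]] := @extend _ _ p s Y (cut m A) (turing_join (orc p) A) aY
  (unbounded_cut m uA) _ (le_join_l _ _) (turing_le_cut m (le_join_r _ _)) avA.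
  by move=> x; rewrite mem_cut => /andP[_ /AR].
have pq : turing_le (prom p) (orc q).
  by rewrite Eo; exact: turing_le_trans (@prom_orc p) (le_join_l _ _).
have okq y : y \in res q -> indep G (adjoin (stem q) y).
  rewrite Er !mem_cut Es => /and3P[_ my /AS]; rewrite in_setE => -[Y' [tY' _ _ iY' _]].
  apply: Hm => // a c aF cF ne; apply/negP => ad.
  have E x : x \in trunc Y s -> chi (trunc Y' s) x.
    by rewrite /chi !mem_trunc -!bit_initseg -tY -tY'.
  have [||] := negP (iY' a a c c _ _).
  - by rewrite /all_in !E.
  - by rewrite /shape !leqnn !eqxx /= andbb.
  - by apply/type_graph_adjP; exists a, c.
by exists (RCond pq (@prom_deg p) okq); split=> //=; rewrite Es initseg_trunc.
Qed.
End ExtendTypes.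

(** * Independent sets that avoid the cone *)

Section IndependentForcing.
Variables (W O h : set nat) (K0 : nat).
Hypothesis dh : degree_le K0 (chi h).
Local Notation rcond := (rcond W O h).

(** A set of more than [(pdeg p + K0) * len p] elements of the reservoir contains,
    for each type, one that is not adjacent to any point of the stem. *)
Lemma rcond_grow (p : rcond) : exists2 q : rcond, rcond_le q p &
  exists2 x, len p <= x < len q & x \in stem q.
Proof.
have [xs [us ss xsA]] := unbounded_seq (@res_unb _ _ p) ((pdeg p + K0) * len p).+1.
pose s := maxn (len p) (\max_(x <- xs) x).+1.
have xls x : x \in xs -> x < s.
  move=> xxs; apply: leq_trans (leq_maxr _ _); rewrite ltnS.
  exact: (@leq_bigmax_seq _ xs xpredT id x xxs isT).
have lps : len p <= s by exact: leq_maxl.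
have [|q [qp lq [x [lx xs' xq]]]] := @extend_types _ _ _ _ dh p s
    (fun t => exists x, [/\ len p <= x, x < s & bit t x]); last first.
  exists q => //; exists x; first by rewrite lx lq.
  by move: xq; rewrite bit_initseg => /andP[].
move=> m pm dm im.
have [||x xxs Hx] := @degree_pigeonhole _ _ (fun a => npair a a) (fun a =>
  npair a a) dm _ (len p) _ us.
- by move=> a b /npair_inj[].
- by rewrite ss.
have xA := xsA x xxs; have lx := res_len xA.
pose Y := [set y | adjoin (stem p) x y].
have YE y : (y \in Y) = adjoin (stem p) x y by exact: mem_set_pred.
have sub : subpred (chi (trunc Y s)) (adjoin (stem p) x).
  by move=> y; rewrite /chi mem_trunc YE => /andP[].
exists Y; split.
- apply/admissibleP; split=> // y ys; rewrite YE /adjoin; case: ltnP => ly.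
    by case: eqP => // E; rewrite E ltnNge lx in ly.
  by case: eqP => [-> _ //|_ /= /stem_len]; rewrite ltnNge ly.
- exact: sub_indep sub (prom_ok xA).
- apply: sub_indep sub _; apply: indep_add_point => // a /stem_len; exact: Hx.
- by exists x; rewrite lx xls // bit_initseg xls // YE /adjoin eqxx.
Qed.

(** The dichotomy for the graphs [X] that prevent a value. [V] lists the
    quadruples of a compatible graph: conflicts inside the stem, or between
    pairs that one element of the reservoir forms with the stem, must be
    absent, which is what keeps a condition valid once [X] joins the promise.
    The bound [K] leaves room for [h] together with a type, whose degree is at
    most [pdeg p + K0]. *)
Lemma rcond_decide (av : avoids W O) c (p : rcond) : exists2 q : rcond, rcond_le q p &
  decides W O (@rcond_le W O h) (fun p => stem p) (fun p => len p) c q.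
Proof.
pose F := stem p; pose A := res p; pose l := len p; pose K := pdeg p + K0 + K0.
pose V a b c d := [&& a \in F, c \in F & (b \in F) && (d \in F) || (b == d) && (b \in A)].
pose T n i r t u := [&& admissible l F (chi A) r u,
  quadb (all_in (bit u)) (chi (prom p)) r,
  quadb (all_in (bit u)) (bit t) r & converges O c n i r u].
pose P n i s t := [&& degree_leb K (bit t) s, quadb V (bit t) s &
  all (fun r => (vertex_bound r <= s) ==> all (fun u =>
    ~~ T n i r t u) (iota 0 (2 ^ r))) (iota 0 s.+1)].
(* [T] is only used for [vertex_bound r <= s], where the truncation of [X] is
   exact; this is why the test inside [P] is monotone. *)
have Tex n i r s X u : vertex_bound r <= s -> T n i r (initseg X s) u =
    [&& admissible l F (chi A) r u, quadb (all_in (bit u)) (chi (prom p)) r,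
       quadb (all_in (bit u)) (chi X) r & converges O c n i r u].
  by move=> rs; rewrite /T quadb_exact.
have Pm n i : segment_monotone (P n i).
  move=> s t X st /and3P[d q /allP H]; apply/and3P; split.
  - exact: degree_leb_mono d.
  - exact: quadb_mono q.
  apply/allP => r; rewrite mem_iota0 => rs; apply/implyP => brs.
  have := H r; rewrite mem_iota0 => /(_ (leq_trans rs (st : s.+1 <= t.+1))) /implyP/(_
    (leq_trans brs st)).
  move=> /allP K'; apply/allP => u /K'; by rewrite !Tex // (leq_trans brs st).
have FO : turing_le F (orc p) by apply: turing_le_bounded; exact: stem_len.
have AO : turing_le A (orc p) by exact: res_orc.
have RO : turing_le (prom p) (orc p) by exact: prom_orc.
have Pd : recpred (orc p) 4 (fun v => P (nth 0 v 0) (nth 0 v 1) (nth 0 v 2) (nth 0 v 3)).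
  have n k i : recfun (orc p) k (fun w => nth 0 w i) by exact: recfun_nth.
  have nb k j i : recfun (orc p) (j + k) (fun w => nth 0 (iter j behead w) i).
    exact: (recfun_iter_behead j (n k i)).
  have bits4 : recpred (orc p) 5 (fun w => bit (nth 0 (behead w) 3) (nth 0 w 0)).
    by apply: recpred_bit; [exact: (nb 4 1)|].
  apply: recpred_and; last apply: recpred_and.
  - apply: (@recpred_all _ _ _ (fun q v => count (adj (bit (nth 0 v 3)) q) (iota 0 (nth
    0 v 2)) <= K)).
      exact: n.
    apply: recpred_leq; last exact: recfun_const.
    apply: (@recfun_count _ _ (fun w => nth 0 (behead w) 2)
      (fun q w => adj (bit (nth 0 (behead w) 3)) (nth 0 w 0) q)); first exact: (nb 4 1).
    by apply: recpred_or; apply: recpred_bit; try exact: (nb 4 2);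
      apply: recfun_npair => //; exact: (nb 5 1).
  - apply: (@recpred_quadb _ _ (fun a b c d v => V a b c d) (fun z v => bit (nth 0 v 3) z)
      (fun v => nth 0 v 2)) => //.
    apply: recpred_and; first exact: recpred_mem.
    apply: recpred_and; first exact: recpred_mem.
    apply: recpred_or; apply: recpred_and; by [exact: recpred_mem|exact: recpred_eq].
  - apply: (@recpred_all _ _ (fun v => (nth 0 v 2).+1) (fun r v =>
    (vertex_bound r <= nth 0 v 2) ==>
      all (fun u => ~~ T (nth 0 v 0) (nth 0 v 1) r (nth 0 v 3) u) (iota 0 (2 ^ r)))).
      exact: recfun_S.
    apply: recpred_imp.
      apply: recpred_leq; last exact: (nb 4 1).
      by apply: recfun_S; do !apply: recfun_npair.
    apply: (@recpred_all _ _ (fun w => 2 ^ nth 0 w 0) (fun u w =>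
      ~~ T (nth 0 (behead w) 0)
      (nth 0 (behead w) 1) (nth 0 w 0) (nth 0 (behead w) 3) u)); first exact: recfun_exp2.
    have Yd : recpred (orc p) (4 + 6) (fun w => all_in (bit (nth 0 (iter 4 behead w) 0))
        (nth 0 w 3) (nth 0 w 2) (nth 0 w 1) (nth 0 w 0)).
      by do !apply: recpred_and; apply: recpred_bit => //; exact: (nb 6 4).
    apply/recpred_not/recpred_and; last apply: recpred_and; last apply: recpred_and.
    + apply: (@recpred_admissible _ _ _ _ (fun x w => x \in A) (fun w =>
      nth 0 (behead w) 0)
        (fun w => nth 0 w 0)) => //; [exact: stem_len|exact: recpred_mem|exact: (nb 5 1)].
    + apply: (@recpred_quadb _ _ (fun a b c d v => all_in (bit (nth 0 v 0)) a b c d)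
        (fun z v => z \in prom p) (fun w => nth 0 (behead w) 0)) => //;
          last exact: (nb 5 1).
      exact: recpred_mem.
    + apply: (@recpred_quadb _ _ (fun a b c d v => all_in (bit (nth 0 v 0)) a b c d)
        (fun z v => bit (nth 0 (iter 2 behead v) 3) z) (fun w =>
          nth 0 (behead w) 0)) => //.
        by apply: recpred_bit => //; exact: (nb 4 3).
      exact: (nb 5 1).
    + apply: recpred_converges => //; try exact: (nb 4 2); try exact: (nb 5 1).
      exact: base_orc.
(* First case: some wrong value is prevented by no graph, so in particular not
   by the union of [h] and any type [m]. Second case: [X] joins the promise. *)
case: (tree_dichotomy (@orc_av _ _ p) Pd Pm) => [[n [s Hs]]|[n [X [HX avX]]]].
- have [|q [qp lq cq]] := @extend_types _ _ _ _ dh p s (converges O c n (n \notin W)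
  s); last first.
    by exists q => //; exists n; left; rewrite lq.
  move=> m pm dm im; pose X := m `|` h.
  have [ih_ _] := indepUP (@stem_ok _ _ _ p).
  have okV : quadfree V (chi X).
    move=> a b a' b' /and3P[aF a'F bb'] sh; rewrite adjU negb_or.
    case/orP: bb' => [/andP[bF b'F]|/andP[/eqP E bA]].
      have ins : all_in (chi F) a b a' b' by rewrite /all_in /chi aF bF a'F.
      by rewrite im //; have [_ ->] := indepUP (@stem_ok _ _ _ p).
    rewrite -{}E in sh *; apply/andP; split.
      apply/negP => /(point_graph_adj pm)[e [_ [/npair_inj[ae be] _]]].
      by have := leq_trans (stem_len aF) (res_len bA); rewrite ae be ltnn.
    have [_ ->] := indepUP (prom_ok bA) => //.
    by rewrite /all_in /adjoin eqxx aF a'F !orbT.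
  have dX : degree_le K (chi X) by apply: degree_leU.
  have HP : ~ all (fun r => (vertex_bound r <= s) ==>
      all (fun u => ~~ T n (n \notin W) r (initseg X s) u) (iota 0 (2 ^ r))) (iota 0
        s.+1).
    move=> H; case/negP: (Hs X); apply/and3P.
    by split; [exact: degree_le_leb|exact: quadfree_quadb|].
  have [r [brs [Y TY]]] : exists r, vertex_bound r <= s /\ exists Y,
    T n (n \notin W) r (initseg X s) (initseg Y r).
    apply: contrapT => H; apply: HP; apply/allP => r _; apply/implyP => brs.
    apply/all_initsegP => Y; apply/negP => TY; apply: H; exists r; split=> //;
      by exists Y.
  rewrite Tex // in TY; case/and4P: TY => aY /indepbP iR /indepbP iX cY.
  have rs : r <= s.
    by apply: leq_trans brs; apply: ltnW; rewrite ltnS;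
      apply: leq_trans (npair_geq_l _ _);
      exact: npair_geq_l.
  have [iM iH] := indepUP iX.
  exists (trunc Y r).
  have sub : subpred (chi (trunc (trunc Y r) s)) (chi (trunc Y r)).
    by move=> x; rewrite /chi mem_trunc => /andP[].
  split.
  + move/admissibleP: aY => [lr H]; apply/admissibleP; split=> [|x xs];
    first exact: leq_trans rs.
    rewrite mem_trunc; case: (ltnP x r) => xr; first exact: H.
    by rewrite ltnNge (leq_trans lr xr).
  + by apply: sub_indep sub _; exact: indepU.
  + exact: sub_indep sub iM.
  + by apply: (converges_mono rs); rewrite initseg_trunc.
- have [HV dX] : quadfree V (chi X) /\ degree_le K (chi X).
    by split; [apply: quadb_limit => s|apply: degree_leb_limit => s]; have /and3P[] :=
      HX s.
  have iF : indep (chi X) (chi F).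
    move=> a b a' b' /and4P[aF bF a'F b'F] sh; apply: HV => //.
    by rewrite /V; move: aF bF a'F b'F; rewrite /chi => -> -> -> ->.
  have [m Hm] := indep_adjoin dX (@stem_len _ _ p) iF.
  have [||q [qp Es El Er Eo]] := @thin _ _ p (cut m A) (turing_join (orc p) X)
     (unbounded_cut m (@res_unb _ _ p)) _ (le_join_l _ _) _ avX.
  + by move=> x; rewrite mem_cut => /andP[].
  + by apply: turing_le_cut; exact: turing_le_trans AO (le_join_l _ _).
  have RXq : turing_le (prom p `|` X) (orc q).
    rewrite Eo; apply/turing_leP.
    apply: (@eq_recfun _ _ (fun v => (nth 0 v 0 \in prom p) || (nth 0 v 0 \in X))).
      by move=> v _; rewrite in_setU.
    apply: recpred_or; apply: recpred_mem; try exact: recfun_nth; last exact: le_join_r.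
    exact: turing_le_trans RO (le_join_l _ _).
  have okq y : y \in res q -> indep (chi (prom p `|` X `|` h)) (adjoin (stem q) y).
    rewrite Er mem_cut Es => /andP[my yA]; have [iR ih] := indepUP (prom_ok yA).
    apply: indepU => //; apply: indepU => //; apply: Hm => // a a' aF a'F ne.
    apply: HV; first by rewrite /V aF a'F eqxx yA orbT.
    have ly := res_len yA; have la := leq_trans (stem_len aF) ly.
    have la' := leq_trans (stem_len a'F) ly.
    by rewrite /shape (ltn_eqF la) (ltn_eqF la') eqxx (negPf ne) (ltnW la) (ltnW la').
  pose q' : rcond := RCond RXq (degree_leU (@prom_deg _ _ _ p) dX) okq.
  exists q'; first by split=> // z zp; rewrite /= in_setU zp.
  exists n; right => r [rq sr]; apply/negP => cr.
  have := HX (vertex_bound (len r)); rewrite /P => /and3P[_ _ /allP/(_ (len r))].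
  have lb : len r < (vertex_bound (len r)).+1.
    by rewrite ltnS; apply: ltnW; rewrite ltnS; apply: leq_trans (npair_geq_l _ _);
      exact: npair_geq_l.
  rewrite mem_iota0 => /(_ lb)/implyP/(_ (leqnn _))/all_initsegP/(_ (stem r))/negP.
  rewrite Tex //; apply.
  have sub Z : (forall z, z \in Z -> z \in prom q') ->
    indep (chi Z) (chi (trunc (stem r) (len r))).
    move=> ZX; rewrite trunc_self => a b a' b' ins sh.
    have [/(_ a b a' b' ins sh) + _] := indepUP (@stem_ok _ _ _ r).
    by apply: contra => /orP[] /ZX/sr zr; apply/orP; [left|right].
  apply/and4P; split=> //.
  + apply: (cond_le_admissible qp rq) => // x; by rewrite Er mem_cut => /andP[].
  + by apply/indepbP/sub => z zp; rewrite /= in_setU zp.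
  + by apply/indepbP/sub => z zX; rewrite /= in_setU zX orbT.
Qed.
End IndependentForcing.

(** The forcing starts with the empty stem, the reservoir [C] and the empty
    promise. *)
Lemma avoiding_independent W O C h K0 : degree_le K0 (chi h) -> avoids W O ->
  turing_le C O -> unbounded C ->
  exists Y, [/\ unbounded Y, subpred (chi Y) (chi C), indep (chi h) (chi Y)
    & avoids W (turing_join O Y)].
Proof.
move=> dh av CO uC.
have st0 : forall x, x \in (set0 : set nat) -> x < 0 by move=> x; rewrite in_set0.
have p0O : turing_le set0 O by exact: turing_le_bounded st0.
have d0 : degree_le 0 (chi set0).
  by move=> p [|q s] //= _; rewrite /adj /chi !in_set0.
pose c0 := Cond st0 (fun x _ => leq0n x) uC (turing_le_refl O) CO av.
have ok0 y : y \in res c0 -> indep (chi (set0 `|` h)) (adjoin (stem c0) y).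
  move=> _ a b c d; rewrite /all_in /adjoin /= !in_set0 !orbF.
  move=> /and4P[/eqP -> /eqP -> /eqP -> /eqP ->].
  by rewrite /shape !eqxx !andbF.
pose p0 : rcond W O h := RCond (rc := c0) p0O d0 ok0.
have [||||||u [Y [[u0 uS] YE uY avY _]]] := @mathias_forcing W O _ (@rcond_le W O h)
    (fun p => stem p) (fun p => len p) (fun _ _ => True) p0.
- exact: rcond_le_refl.
- exact: rcond_le_trans.
- by move=> p q [/cond_le_len].
- by move=> p _; exact: rcond_grow dh p.
- by move=> _ p _; exists p => //; exact: rcond_le_refl.
- by move=> c p _; exact: rcond_decide dh av c p.
exists Y; split=> //.
- move=> x; rewrite /chi; have [xl ->] := YE x.+1; last exact: xl.
  have [[_ _ H _ _] _] := uS 0 x.+1 (leq0n _); rewrite u0 in H; exact: H.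
- move=> a b c d /and4P[ha hb hc hd]; pose n := (a + b + c + d).+1.
  have [nl E] := YE n.
  have lt x : x < n -> chi Y x -> chi (stem (u n)) x.
    by move=> xn; rewrite /chi E // (leq_trans xn).
  have [_ iH] := indepUP (@stem_ok _ _ _ (u n)).
  apply: iH; apply/and4P; split; apply: lt => //; rewrite ltnS.
  + by rewrite -!addnA leq_addr.
  + by rewrite -!addnA addnCA leq_addr.
  + by rewrite -addnA addnCA leq_addr.
  + exact: leq_addl.
Qed.

(** * From independent sets to rainbows *)

Lemma unbounded_infinite Y : unbounded Y -> infinite_set Y.
Proof.
move=> uY /finite_seqP[s Ys]; have [x xs] := uY (\max_(y <- s) y).+1.
rewrite Ys in_setE /= => xs'.
by have := @leq_bigmax_seq _ s xpredT id x xs' isT; rewrite leqNgt xs.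
Qed.

(** Quantifies over [n] variables, prepended one by one to the list [v]. The
    bound [S] is read off [v], so the variables already bound are dropped. *)
Fixpoint ball (n : nat) (S : seq nat -> nat) (P : seq nat -> bool) (v : seq nat) : bool :=
  if n is m.+1 then all (fun x => ball m (S \o behead) P (x :: v)) (iota 0 (S v)) else
    P v.

Lemma recpred_ball O n k S P : recfun O k S -> recpred O (n + k) P ->
  recpred O k (ball n S P).
Proof.
elim: n k S => [|n IH] k S HS HP //=.
apply: recpred_all => //; rewrite addSnnS in HP.
apply: eq_recfun (IH _ _ (recfun_behead HS) HP) => -[|x v] //.
Qed.

Lemma ballP n S (P : seq nat -> bool) v : reflect
  (forall l, size l = n -> all (fun x => x < S v) l -> P (catrev l v)) (ball n S P v).
Proof.
elim: n S v => [|n IH] S v /=.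
  by apply: (iffP idP) => [H [|]//|H]; exact: (H [::]).
apply: (iffP allP) => [H [|x l] //= [sl] /andP[xS lS]|H x].
  by have := H x; rewrite mem_iota0 => /(_ xS)/IH; apply.
by rewrite mem_iota0 => xS; apply/IH => l sl lS; apply: (H (x :: l)); rewrite /= ?sl ?xS.
Qed.

Lemma eventually_uniform N (Q : nat -> nat -> Prop) :
  (forall a, a < N -> exists m, forall y, m <= y -> Q a y) ->
  exists m, forall y, m <= y -> forall a, a < N -> Q a y.
Proof.
elim: N => [|N IH] H; first by exists 0.
have [|m Hm] := IH; first by move=> a aN; apply: H; exact: ltnW.
have [m' Hm'] := H N (ltnSn N).
exists (maxn m m') => y; rewrite geq_max => /andP[h h'] a.
by rewrite ltnS leq_eqVlt => /orP[/eqP ->|]; [exact: Hm'|exact: Hm].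
Qed.

Lemma triple012 : sorted ltn [tuple 0; 1; 2]. Proof. by []. Qed.

(** A total version of the triple constructor, to treat [f] as a function on
    numbers. *)
Definition mk_triple (a b c : nat) : triple :=
  insubd (exist _ [tuple 0; 1; 2] triple012 : triple) [tuple a; b; c].

Lemma val_mk_triple a b c : val (mk_triple a b c) =
  [:: if a < b < c then a else 0; if a < b < c then b else 1;
    if a < b < c then c else 2] :> seq nat.
Proof. by rewrite /mk_triple val_insubd /= andbT; case: ifP. Qed.

Lemma mk_triple_inj a b c a' b' c' : a < b < c -> a' < b' < c' ->
  mk_triple a b c = mk_triple a' b' c' ->
  [/\ a = a', b = b' & c = c'].
Proof.
move=> h h' E; have := val_mk_triple a b c; rewrite E val_mk_triple h h'.
by move=> [-> -> ->].
Qed.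

Lemma mk_tripleP (t : triple) : exists a b c, a < b < c /\ t = mk_triple a b c.
Proof.
case: t => -[[|a [|b [|c [|]]]] //= st] h; exists a, b, c.
have abc : a < b < c by move: h; rewrite /= andbT.
split=> //; apply: val_inj; apply: val_inj; apply: etrans (esym (val_mk_triple a b c)).
by rewrite abc.
Qed.

Section Assembly.
Variables (W Z : set nat) (f : triple -> nat).
Hypotheses (nWZ : avoids W Z) (f2 : two_bounded f) (fZ : computable_from Z f).

Let F (a b c : nat) : nat := f (mk_triple a b c).

Lemma no_three t1 t2 t3 : f t1 = f t2 -> f t2 = f t3 -> t1 <> t2 -> t1 <> t3 ->
  t2 <> t3 -> False.
Proof.
move=> e12 e23 n12 n13 n23; have /pcard_leP[g] := f2 (f t2).
have inA t : f t = f t2 -> t \in f @^-1` [set f t2] by move=> E; rewrite in_setE.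
have lt2 t : f t = f t2 -> g t < 2 by move=> E; exact: (@funS _ _ _ _ g t E).
have gi t t' : f t = f t2 -> f t' = f t2 -> g t = g t' -> t = t'.
  by move=> E E'; apply: (@inj _ _ _ g); exact: inA.
have := lt2 t1 e12; have := lt2 t2 erefl; have := lt2 t3 (esym e23).
have := gi t1 t2 e12 erefl; have := gi t1 t3 e12 (esym e23); have :=
  gi t2 t3 erefl (esym e23).
case: (g t1) (g t2) (g t3) => [|[|//]] [|[|//]] [|[|//]] H1 H2 H3 _ _ _;
  by [apply: n12; exact: H3|apply: n13; exact: H2|apply: n23; exact: H1].
Qed.

(** A code for [f] may diverge outside increasing triples, hence the default
    values of [mk_triple] are substituted before it is called. *)
Lemma recfunF : recfun Z 3 (fun v => F (nth 0 v 0) (nth 0 v 1) (nth 0 v 2)).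
Proof.
have H (i j : nat) : recfun Z 3 (fun v =>
    if nth 0 v 0 < nth 0 v 1 < nth 0 v 2 then nth 0 v i else j).
  apply: recfun_if; [|exact: recfun_nth|exact: recfun_const].
  by apply: recpred_and; apply: recpred_leq; try apply: recfun_S; exact: recfun_nth.
have [[c Hc] [c0 H0] [c1 H1] [c2 H2]] := And4 fZ (H 0 0) (H 1 1) (H 2 2).
exists (Comp c [:: c0; c1; c2]) => v sv; apply/eval_CompP.
exists (val (mk_triple (nth 0 v 0) (nth 0 v 1) (nth 0 v 2))); last exact: Hc.
rewrite val_mk_triple; split=> // -[|[|[|]]] // _ /=; [exact: H0|exact: H1|exact: H2].
Qed.

Definition rainbow_on (P : pred nat) : Prop := forall a b c a' b' c',
  [&& P a, P b & P c] -> [&& P a', P b' & P c'] -> a < b < c -> a' < b' < c' ->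
  ~~ [&& a == a', b == b' & c == c'] -> F a b c != F a' b' c'.

Let rainbow_test (w : seq nat) : bool :=
  [&& bit (nth 0 w 6) (nth 0 w 5), bit (nth 0 w 6) (nth 0 w 4) &
    bit (nth 0 w 6) (nth 0 w 3)]
  ==> ([&& bit (nth 0 w 6) (nth 0 w 2), bit (nth 0 w 6) (nth 0 w 1) &
    bit (nth 0 w 6) (nth 0 w 0)]
  ==> ((nth 0 w 5 < nth 0 w 4 < nth 0 w 3) ==> ((nth 0 w 2 < nth 0 w 1 < nth 0 w 0) ==>
  (~~ [&& nth 0 w 5 == nth 0 w 2, nth 0 w 4 == nth 0 w 1 & nth 0 w 3 == nth 0 w 0] ==>
  (F (nth 0 w 5) (nth 0 w 4) (nth 0 w 3) != F (nth 0 w 2) (nth 0 w 1) (nth 0 w 0)))))).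

Let rainbow_code (t s : nat) : bool := ball 6 (fun v => nth 0 v 1) rainbow_test [:: t; s].

Lemma rainbow_codeP t s : reflect (rainbow_on (fun x => (x < s) &&
  bit t x)) (rainbow_code t s).
Proof.
apply: (iffP (ballP _ _ _ _)) => H.
  move=> a b c a' b' c' /and3P[/andP[a1 a2] /andP[b1 b2] /andP[c1 c2]].
  move=> /and3P[/andP[a1' a2'] /andP[b1' b2'] /andP[c1' c2']] l l' ne.
  have := H [:: a; b; c; a'; b'; c'] erefl; rewrite /rainbow_test /= a1 b1 c1 a1' b1'
    c1' => /(_ isT).
  by rewrite a2 b2 c2 a2' b2' c2' l l' ne.
move=> [|a [|b [|c [|a' [|b' [|c' [|]]]]]]] //= _ /and5P[a1 b1 c1 a1' /and3P[b1' c1' _]].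
rewrite /rainbow_test /=; apply/implyP => /and3P[a2 b2 c2]; apply/implyP =>
  /and3P[a2' b2' c2'].
apply/implyP => l; apply/implyP => l'; apply/implyP; apply: H => //.
  by rewrite a1 b1 c1 a2 b2 c2.
by rewrite a1' b1' c1' a2' b2' c2'.
Qed.

Lemma recpred_rainbow_code O k t s : turing_le Z O -> recfun O k t -> recfun O k s ->
  recpred O k (fun v => rainbow_code (t v) (s v)).
Proof.
move=> ZO; apply: (recfun_subst2 (f := fun t s => rainbow_code t s)).
apply: (@eq_recfun _ _ (ball 6 (fun v => nth 0 v 1) rainbow_test)).
  by move=> [|t' [|s' [|]]] // _.
have n i : recfun O 8 (fun w => nth 0 w i) by exact: recfun_nth.
have Fd i j l : recfun O 8 (fun w => F (nth 0 w i) (nth 0 w j) (nth 0 w l)).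
  exact: (recfun_subst3 (f := F) (recfun_le ZO recfunF)).
have d3 i j l : recpred O 8 (fun w => nth 0 w i < nth 0 w j < nth 0 w l).
  by apply: recpred_and; apply: recpred_leq => //; apply: recfun_S.
have b3 i j l : recpred O 8 (fun w => [&& bit (nth 0 w 6) (nth 0 w i),
  bit (nth 0 w 6) (nth 0 w j)
    & bit (nth 0 w 6) (nth 0 w l)]).
  by do !apply: recpred_and; exact: recpred_bit.
apply: recpred_ball; first exact: recfun_nth.
do 4 apply: recpred_imp => //; apply: recpred_imp; last by apply/recpred_not/recpred_eq.
by apply: recpred_not; do !apply: recpred_and; exact: recpred_eq.
Qed.

Section Thinning.
Variable Y : set nat.

Let greedy_code (y : nat) : nat :=
  primrec y 0 (fun i r => if (i \in Y) && rainbow_code (r + 2 ^ i) i.+1 then r + 2 ^ i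
    else r).

(** The number [greedy_code x] codes the elements kept below [x]
    ([initseg_greedy]), and adding [2 ^ x] to it adds [x] to that set. *)
Definition greedy : set nat := [set x | (x \in Y) &&
  rainbow_code (greedy_code x + 2 ^ x) x.+1].

Lemma mem_greedy x : (x \in greedy) = (x \in Y) &&
  rainbow_code (greedy_code x + 2 ^ x) x.+1.
Proof. exact: (mem_set_pred (fun x => (x \in Y) &&
  rainbow_code (greedy_code x + 2 ^ x) x.+1)). Qed.

Lemma initseg_greedy y : greedy_code y = initseg greedy y.
Proof.
have GS n : greedy_code n.+1 = if (n \in Y) && rainbow_code (greedy_code n + 2 ^ n)
  n.+1 then greedy_code n + 2 ^ n else greedy_code n by [].
elim: y => // y IH; rewrite /initseg bitcodeS -/(initseg greedy y) -IH mem_greedy GS.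
by case: ifP; rewrite ?mul1n ?addn0.
Qed.

Lemma greedyP x : reflect (x \in Y /\ rainbow_on (adjoin (trunc greedy x) x)) (x \in
  greedy).
Proof.
have E y : (y < x.+1) && bit (greedy_code x + 2 ^ x) y = adjoin (trunc greedy x) x y.
  have -> : greedy_code x + 2 ^ x = bitcode (adjoin greedy x) x.+1.
    rewrite bitcodeS /adjoin eqxx mul1n initseg_greedy; congr (_ + _);
      apply: eq_bitcode => z zx.
    by rewrite ltn_eqF.
  rewrite bit_bitcode andbA andbb /adjoin mem_trunc ltnS; by case: ltngtP.
rewrite mem_greedy; apply: (iffP andP) => -[xY]; split=> //.
  by move: b => /rainbow_codeP; congr rainbow_on; apply/funext => y; exact: E.
by apply/rainbow_codeP; move: b; congr rainbow_on; apply/funext => y; rewrite E.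
Qed.

Lemma turing_le_greedy O : turing_le Z O -> turing_le Y O -> turing_le greedy O.
Proof.
move=> ZO YO; apply: (turing_le_recpred (p := fun x => (x \in Y) &&
  rainbow_code (greedy_code x + 2 ^ x) x.+1)).
have e2 k e : recfun O k e -> recfun O k (fun v => 2 ^ e v) by exact: recfun_exp2.
have Gd k e : recfun O k e -> recfun O k (fun v => greedy_code (e v)).
  move=> He; apply: recfun_primrec => //; first exact: recfun_const.
  have n i : recfun O k.+2 (fun w => nth 0 w i) by exact: recfun_nth.
  have rd : recfun O k.+2 (fun w => nth 0 w 1 + 2 ^ nth 0 w 0).
    by apply: recfun_add => //; exact: e2.
  apply: recfun_if => //; apply: recpred_and; first exact: recpred_mem.
  by apply: recpred_rainbow_code => //; exact: recfun_S.
have n0 : recfun O 1 (fun v => nth 0 v 0) by exact: recfun_nth.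
apply: recpred_and; first exact: recpred_mem.
by apply: recpred_rainbow_code => //; [apply: recfun_add;
  [exact: Gd|exact: e2]|exact: recfun_S].
Qed.

Lemma greedy_rainbow_on : rainbow_on (chi greedy).
Proof.
move=> a b c a' b' c' /and3P[ha hb hc] /and3P[ha' hb' hc'] l l' ne.
have /andP[ab bc] := l; have /andP[ab' bc'] := l'.
pose M := maxn c c'.
have MX : M \in greedy by rewrite /M; case: (leqP c c').
have [_ rM] := greedyP _ MX.
have in_ x : x <= M -> chi greedy x -> adjoin (trunc greedy M) M x.
  by rewrite leq_eqVlt /chi => /orP[/eqP ->|xM] xg;
    rewrite /adjoin ?eqxx // mem_trunc xM xg orbT.
have [cM cM'] : c <= M /\ c' <= M by rewrite leq_maxl leq_maxr.
apply: rM => //; apply/and3P; split; apply: in_ => //.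
- by apply: leq_trans cM; apply: ltnW; exact: ltn_trans bc.
- by apply: leq_trans cM; exact: ltnW.
- by apply: leq_trans cM'; apply: ltnW; exact: ltn_trans bc'.
- by apply: leq_trans cM'; exact: ltnW.
Qed.

Lemma rainbow_on_rainbow X : rainbow_on (chi X) -> rainbow f X.
Proof.
move=> rX t t'; have [a [b [c [l ->]]]] := mk_tripleP t; have [a' [b' [c' [l' ->]]]] :=
  mk_tripleP t'.
have sub p q r : p < q < r -> mk_triple p q r \in triples X -> [&& chi X p, chi X q &
  chi X r].
  move=> lt; rewrite in_setE /triples /= => H.
  have E := val_mk_triple p q r; rewrite lt in E.
  have M x : x \in [:: p; q; r] -> x \in X by rewrite -E; exact: H.
  by apply/and3P; split; apply: M; rewrite !inE eqxx ?orbT.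
move=> /(sub _ _ _ l) h /(sub _ _ _ l') h' E; apply: contrapT => ne.
apply: (elimN eqP (rX a b c a' b' c' h h' l l' _)) => //.
by apply/negP => /and3P[/eqP ea /eqP eb /eqP ec]; apply: ne; rewrite ea eb ec.
Qed.

Variable C : set nat.
Hypotheses (uC : unbounded C) (cohC : forall a b a' b', exists l (e : bool), forall x,
  l <= x -> x \in C -> (F a b x == F a' b' x) = e).

Definition limit_graph : set nat := [set z | exists a b a' b',
  [/\ z = npair (npair a b) (npair a' b'), a < b, a' < b', ~~ ((a == a') && (b == b')) &
     exists l, forall x, l <= x -> x \in C -> F a b x = F a' b' x]].

Lemma limit_graph_adj p q : adj (chi limit_graph) p q -> exists a b a' b',
  [/\ p = npair a b, q = npair a' b', a < b, a' < b' &
     exists l, forall x, l <= x -> x \in C -> F a b x = F a' b' x] /\ (a, b) <> (a', b').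
Proof.
move=> /orP[]; rewrite /chi in_setE => -[a [b [a' [b' [/npair_inj[-> ->] ab ab' ne [l
  Hl]]]]]].
- exists a, b, a', b'; split; first by split=> //; exists l.
  by move=> [ea eb]; rewrite ea eb !eqxx in ne.
- exists a', b', a, b; split; first by split=> //; exists l => x lx /Hl ->.
  by move=> [ea eb]; rewrite ea eb !eqxx in ne.
Qed.

(** A pair adjacent to two others would, with a large element of [C] on top,
    give three triples of the same color. *)
Lemma degree_limit_graph : degree_le 1 (chi limit_graph).
Proof.
move=> p [|q1 [|q2 s]] //= /andP[]; rewrite in_cons negb_or => /andP[/eqP ne _] _.
move=> /and3P[/limit_graph_adj[a [b [c [d [[p1 q1E ab cd [l Hl]] n1]]]]]].
move=> /limit_graph_adj[a' [b' [c' [d' [[p2 q2E _ cd' [l' Hl']] n2]]]]] _.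
rewrite p1 in p2; move/npair_inj: p2 => [ea eb]; rewrite -{}ea -{}eb in Hl' n2.
rewrite {}q1E {}q2E in ne.
have [x xl xC] := uC (l + l' + b + d + d').+1.
have lx y : y <= l + l' + b + d + d' -> y < x by move=> h; exact: leq_ltn_trans xl.
have lx1 : l < x by apply: lx; rewrite -!addnA leq_addr.
have lx2 : l' < x by apply: lx; rewrite -!addnA addnCA leq_addr.
have lx3 : b < x by apply: lx; rewrite -addnA addnAC leq_addl.
have lx4 : d < x by apply: lx; rewrite addnAC leq_addl.
have lx5 : d' < x by apply: lx; exact: leq_addl.
have s1 : a < b < x by rewrite ab.
have s2 : c < d < x by rewrite cd.
have s3 : c' < d' < x by rewrite cd'.
have e1 := Hl x (ltnW lx1) xC; have e2 := Hl' x (ltnW lx2) xC.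
have := no_three e1; rewrite -/(F c d x) -e1 => /(_ _ e2) [].
- by move=> /(mk_triple_inj s1 s2) [ea eb _]; apply: n1; rewrite ea eb.
- by move=> /(mk_triple_inj s1 s3)[ea eb _]; apply: n2; rewrite ea eb.
- by move=> /(mk_triple_inj s2 s3)[ea eb _]; apply: ne; rewrite ea eb.
Qed.

Hypotheses (uY : unbounded Y) (YC : subpred (chi Y) (chi C))
  (iY : indep (chi limit_graph) (chi Y)).

(** Suppose that all elements kept are below [l]. A later element [y] of [Y] is
    rejected only if, with pairs below [l], it forms a triple sharing its
    color with a triple below [l], which happens for finitely many [y] by
    2-boundedness ([Q1]), or with another triple of top [y], which happens
    for finitely many [y] because the two pairs are not adjacent ([Q2]). *)
Lemma greedy_unbounded : unbounded greedy.
Proof.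
apply: contrapT => /existsNP[l Hl].
have gl x : x \in greedy -> x < l.
  by move=> xg; rewrite ltnNge; apply/negP => lx; apply: Hl; exists x.
pose Q1 a b c y := a < b < c -> forall a' b', a' < b' < y -> l <= y ->
  F a b c != F a' b' y.
have [m1 Hm1] : exists m, forall y, m <= y ->
    forall a, a < l -> forall b, b < l -> forall c, c < l -> Q1 a b c y.
  apply: (eventually_uniform (Q := fun a y =>
    forall b, b < l -> forall c, c < l -> Q1 a b c y)) => a _.
  apply: (eventually_uniform (Q := fun b y => forall c, c < l -> Q1 a b c y)) => b _.
  apply: (eventually_uniform (Q := fun c y => Q1 a b c y)) => c cl.
  have [[y [a' [b' [abc l' ly /eqP E]]]]|H] := pselect (exists y a' b',
      [/\ a < b < c, a' < b' < y, l <= y & F a b c == F a' b' y]); last first.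
    exists 0 => y _ abc a' b' l' ly; apply/negP => E; apply: H; by exists y, a', b'.
  (* past the only triple sharing the color of a, b, c *)
  exists y.+1 => y' yy' _ a2 b2 l2 ly'; apply/negP => /eqP E'.
  have := no_three (esym E) E'; apply.
  - by move=> /(mk_triple_inj l' abc)[_ _ yc]; rewrite yc leqNgt cl in ly.
  - by move=> /(mk_triple_inj l' l2)[_ _ ye]; rewrite ye ltnn in yy'.
  - by move=> /(mk_triple_inj abc l2)[_ _ yc]; rewrite -yc leqNgt cl in ly'.
pose Q2 a b a' b' y := y \in C -> all_in (chi Y) a b a' b' -> a < b -> a' < b' ->
  ~~ ((a == a') && (b == b')) -> F a b y != F a' b' y.
have [m2 Hm2] : exists m, forall y, m <= y -> forall a, a < l -> forall b, b < l ->
    forall a', a' < l -> forall b', b' < l -> Q2 a b a' b' y.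
  apply: (eventually_uniform (Q := fun a y => forall b, b < l ->
    forall a', a' < l -> forall b', b' < l -> Q2 a b a' b' y)) => a _.
  apply: (eventually_uniform (Q := fun b y =>
    forall a', a' < l -> forall b', b' < l -> Q2 a b a' b' y)) => b _.
  apply: (eventually_uniform (Q := fun a' y =>
    forall b', b' < l -> Q2 a b a' b' y)) => a' _.
  apply: (eventually_uniform (Q := fun b' y => Q2 a b a' b' y)) => b' _.
  have [k [e He]] := cohC a b a' b'; exists k => y ky yC ins ab ab' ne.
  (* were the two colors equal almost always, the pairs would be adjacent *)
  rewrite He //; apply/negP => et; have := iY ins.
  rewrite /shape (ltnW ab) (ltnW ab') (ltn_eqF ab) (ltn_eqF ab') eqxx ne.
  move=> /(_ isT)/negP; apply.
  apply/orP; left; rewrite /chi in_setE; exists a, b, a', b'; split=> //.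
  by exists k => x kx xC; apply/eqP; rewrite He.
have [y] := uY (maxn l (maxn m1 m2)); rewrite !geq_max => /and3P[ly my1 my2] yY.
have : y \in greedy; last by move=> /gl; rewrite ltnNge ly.
apply/greedyP; split=> // a b c a' b' c'; rewrite /adjoin.
have inl x : (x == y) || (x \in trunc greedy y) -> x <> y -> x < l /\ x \in greedy.
  move=> /orP[/eqP -> //|]; rewrite mem_trunc => /andP[_ xg] _; split=> //; exact: gl.
have ley x : (x == y) || (x \in trunc greedy y) -> x <= y.
  by move=> /orP[/eqP -> //|]; rewrite mem_trunc => /andP[/ltnW].
move=> /and3P[ha hb hc] /and3P[ha' hb' hc'] lt lt' ne.
have /andP[ab bc] := lt; have /andP[ab' bc'] := lt'.
have by_ : b < y := leq_trans bc (ley c hc).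
have by' : b' < y := leq_trans bc' (ley c' hc').
have neq x : x < y -> x <> y by move=> xy E; rewrite E ltnn in xy.
have [al ag] := inl a ha (neq a (ltn_trans ab by_)).
have [bl bg] := inl b hb (neq b by_).
have [al' ag'] := inl a' ha' (neq a' (ltn_trans ab' by')).
have [bl' bg'] := inl b' hb' (neq b' by').
have gY x : x \in greedy -> chi Y x by move=> /greedyP[].
have [cy|cy] := pselect (c = y); have [cy'|cy'] := pselect (c' = y).
- rewrite cy cy' in ne *; rewrite eqxx andbT in ne.
  apply: Hm2 => //; first exact: YC.
  by rewrite /all_in !gY.
- have [cl' cg'] := inl c' hc' cy'; rewrite eq_sym cy; apply: Hm1 => //.
  by rewrite ab by_.
- have [cl cg] := inl c hc cy; rewrite cy'; apply: Hm1 => //.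
  by rewrite ab' by'.
- have [cl cg] := inl c hc cy; have [cl' cg'] := inl c' hc' cy'.
  by apply: greedy_rainbow_on => //; apply/and3P.
Qed.
End Thinning.

Lemma rainbow_exists : exists X : set nat,
  [/\ infinite_set X, rainbow f X & avoids W (turing_join Z X)].
Proof.
pose S k : set nat := if @unpickle (nat * nat * nat * nat)%type k is Some (a, b, a', b')
  then [set x | F a b x == F a' b' x] else set0.
have [C [uC avC cohC]] := avoiding_cohesive S nWZ.
have coh a b a' b' : exists l (e : bool), forall x,
    l <= x -> x \in C -> (F a b x == F a' b' x) = e.
  have [l [e He]] := cohC (pickle (a, b, a', b')); exists l, e => x lx xC.
  by rewrite -(He x lx xC) /S pickleK (mem_set_pred (fun x => F a b x == F a' b' x)).
have [Y [uY YC iY avY]] := avoiding_independent (degree_limit_graph uC) avC (le_join_r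
  Z C) uC.
exists (greedy Y); split.
- exact: unbounded_infinite (greedy_unbounded coh uY YC iY).
- exact/rainbow_on_rainbow/greedy_rainbow_on.
- have ZO : turing_le Z (turing_join (turing_join Z C) Y).
    exact: turing_le_trans (le_join_l _ _) (le_join_l _ _).
  apply: avoids_le avY; apply: le_join => //.
  by apply: turing_le_greedy => //; exact: le_join_r.
Qed.
End Assembly.

Theorem lemma3p2 (W Z : set nat) (f : triple -> nat)
    (nWZ : ~ turing_le W Z) (f2 : two_bounded f) (fZ : computable_from Z f) :
  exists X : set nat,
    [/\ infinite_set X, rainbow f X & ~ turing_le W (turing_join Z X)].
Proof. exact: rainbow_exists. Qed.
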